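(* Let $V\ge 0$ on $\mathbb{R}^n$ with $V\not\equiv0$ and $V\in\mathrm{RH}_q(\mathbb{R}^n)$ for some $q>n/2$, and let $L=-\Delta+V$. If $f\in\mathrm{CMO}_L(\mathbb{R}^n)$, then for every $\varepsilon>0$ there exists a constant $\sigma>0$ such that $$\sup_{B:\,r_B\le\sigma,\ r_B\ge\rho(x_B)}\left(|B|^{-1}\int_B|f(y)|^2\,dy\right)^{1/2}<\varepsilon .$$
   Context: Balls: $B=B(x_B,r_B)$ is the ball in $\mathbb{R}^n$ with center $x_B$ and radius $r_B>0$; $f_B=|B|^{-1}\int_B f(x)\,dx$. A supremum over an empty family of balls is $0$. Reverse Hölder class: a nonnegative locally integrable $V$ is in $\mathrm{RH}_q(\mathbb{R}^n)$ if there is $C>0$ with $\left(|B|^{-1}\int_B V(x)^q\,dx\right)^{1/q}\le C|B|^{-1}\int_B V(x)\,dx$ for all balls $B\subset\mathbb{R}^n$. Critical radius: $\rho(x)=\sup\{r>0:\ r^{2-n}\int_{B(x,r)}V(h)\,dh\le 1\}$. Under the assumptions on $V$ one has $0<\rho(x)<\infty$ for all $x$. $\mathrm{BMO}_L(\mathbb{R}^n)$ is the space of locally integrable functions $f$ with $$\|f\|_{\mathrm{BMO}_L}:=\sup_{B}\frac1{|B|}\int_B|f(x)-f_B|\,dx+\sup_{B:\,r_B>\rho(x_B)}\frac1{|B|}\int_B|f(x)|\,dx<\infty .$$ $\mathrm{CMO}_L(\mathbb{R}^n)$ is the closure in the norm $\|\cdot\|_{\mathrm{BMO}_L}$ of the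 space $C_0^\infty(\mathbb{R}^n)$ of compactly supported smooth functions. *)

(* Defs.v *)
From HB Require Import structures.
From mathcomp Require Import all_boot all_order all_algebra.
From mathcomp Require Import all_classical all_reals all_analysis.
Set Implicit Arguments.
Unset Strict Implicit.
Unset Printing Implicit Defensive.
Import Order.TTheory GRing.Theory Num.Theory.
Import numFieldNormedType.Exports.
Local Open Scope classical_set_scope.
Local Open Scope ring_scope.

(** R^n is 'rV[R]_n. Its library norm is the maximum norm, which is used here
    only through the topology; balls are Euclidean and defined below. *)

Section lebesgue_measure_rV.
Context {R : realType} {n : nat}.
Implicit Types (A : set 'rV[R]_n) (Q : 'rV[R]_n * 'rV[R]_n).
Local Open Scope ereal_scope.

Definition box Q : set 'rV[R]_n :=
  [set x | forall i, (Q.1 ord0 i < x ord0 i <= Q.2 ord0 i)%R].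

Definition box_vol Q : R := (\prod_(i < n) Num.max 0 (Q.2 ord0 i - Q.1 ord0 i))%R.

Definition box_cover A : set (set ('rV[R]_n * 'rV[R]_n)) :=
  [set F | countable F /\ A `<=` \bigcup_(Q in F) box Q].

Definition lebesgue_outer A : \bar R :=
  ereal_inf [set \esum_(Q in F) (box_vol Q)%:E | F in box_cover A].

Lemma box_vol_ge0 Q : (0 <= box_vol Q)%R.
Proof. by apply: prodr_ge0 => i _; rewrite le_max lexx. Qed.

Let vol_ge0 Q : 0 <= (box_vol Q)%:E.
Proof. by rewrite lee_fin box_vol_ge0. Qed.

Lemma lebesgue_outer_ge0 A : 0 <= lebesgue_outer A.
Proof. by apply: le_ereal_inf_tmp => x [F _ <-]; apply: esum_ge0. Qed.

Lemma le_lebesgue_outer :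
  {homo lebesgue_outer : A B / A `<=` B >-> A <= B}.
Proof.
move=> A B AB; apply/ereal_inf_le_tmp => x [F [cF BF]] <-.
by exists F => //; split => //; apply: subset_trans AB BF.
Qed.

Lemma lebesgue_outer0 : lebesgue_outer set0 = 0.
Proof.
apply/eqP; rewrite eq_le lebesgue_outer_ge0 andbT.
apply: ereal_inf_lbound; exists set0; last by rewrite esum_set0.
by split=> //; exact: countable0.
Qed.

Let esum_bigcup_le (F : (set ('rV[R]_n * 'rV[R]_n))^nat) :
  \esum_(Q in \bigcup_k F k) (box_vol Q)%:E <=
  \sum_(k <oo) \esum_(Q in F k) (box_vol Q)%:E.
Proof.
rewrite seqDU_bigcup_eq esum_bigcupT; [|exact: trivIset_seqDU|exact: vol_ge0].
rewrite nneseries_esumT; last by move=> k; apply: esum_ge0.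
apply: le_esum => k _; rewrite esum_mkcond [leRHS]esum_mkcond.
apply: le_esum => Q _; case: ifPn => [|_]; last by case: ifPn.
by rewrite inE => -[FQ _]; rewrite mem_set.
Qed.

Lemma lebesgue_outer_sigma_subadditive : sigma_subadditive lebesgue_outer.
Proof.
move=> A; have [[i ioo]|] := pselect (exists i, lebesgue_outer (A i) = +oo).
  rewrite (eseries_pinfty _ _ ioo) ?leey// => k _.
  by rewrite -ltNye (lt_le_trans _ (lebesgue_outer_ge0 _)).
rewrite -forallNE => Aoo.
apply/lee_addgt0Pr => e e0.
apply: le_trans (epsilon_trick xpredT _ (ltW e0)); last first.
  by move=> k; exact: lebesgue_outer_ge0.
have [F PF] : {F : (set ('rV[R]_n * 'rV[R]_n))^nat & forall k,
    box_cover (A k) (F k) /\ \esum_(Q in F k) (box_vol Q)%:E <=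
      lebesgue_outer (A k) + (e / (2 ^ k.+1)%:R)%:E}.
  apply: (@choice _ _ (fun k G => box_cover (A k) G /\
    \esum_(Q in G) (box_vol Q)%:E <=
      lebesgue_outer (A k) + (e / (2 ^ k.+1)%:R)%:E)) => k.
  have ek : (0 < e / (2 ^ k.+1)%:R)%R by rewrite divr_gt0// ltr0n expn_gt0.
  have fk : lebesgue_outer (A k) \is a fin_num.
    by rewrite ge0_fin_numE ?lebesgue_outer_ge0// ltey; apply/eqP/Aoo.
  have [_ [G cG <-] /ltW leG] := lb_ereal_inf_adherent ek fk.
  by exists G.
apply: (@le_trans _ _ (\esum_(Q in \bigcup_k F k) (box_vol Q)%:E)).
  apply: ereal_inf_lbound; exists (\bigcup_k F k) => //; split.
    by apply: bigcup_countable => // k _; exact: (PF k).1.1.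
  move=> x [k _ /(PF k).1.2 [Q FQ Qx]].
  by exists Q => //; exists k.
apply: (le_trans (esum_bigcup_le F)).
by apply: lee_nneseries => k *; [exact: esum_ge0 | exact: (PF k).2].
Qed.

HB.instance Definition _ := isOuterMeasure.Build R 'rV[R]_n lebesgue_outer
  lebesgue_outer0 lebesgue_outer_ge0 le_lebesgue_outer
  lebesgue_outer_sigma_subadditive.

End lebesgue_measure_rV.

(** R^n with the sigma-algebra of Lebesgue measurable sets. *)
Notation lebesgue_rV R n := (caratheodory_type (@lebesgue_outer R n)).

Section leb.
Context {R : realType} {n : nat}.

Definition leb : set (lebesgue_rV R n) -> \bar R := @lebesgue_outer R n.

Let leb0 : leb set0 = 0%E.
Proof. exact: lebesgue_outer0. Qed.

Let leb_ge0 A : (0 <= leb A)%E.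
Proof. exact: lebesgue_outer_ge0. Qed.

Let leb_sigma_additive : semi_sigma_additive leb.
Proof. exact: caratheodory_measure_sigma_additive. Qed.

HB.instance Definition _ := isMeasure.Build _ _ _ leb
  leb0 leb_ge0 leb_sigma_additive.

End leb.

Section euclidean_balls.
Context {R : realType} {n : nat}.
Implicit Types (f : 'rV[R]_n -> R) (g : 'rV[R]_n -> \bar R) (x : 'rV[R]_n).

Definition enorm x : R := Num.sqrt (\sum_(i < n) x ord0 i ^+ 2).

Definition eball x (r : R) : set 'rV[R]_n := [set y | enorm (y - x) < r].

Definition mean f x r : R :=
  (fine (leb (eball x r)))^-1 * \int[leb]_(y in eball x r) f y.

(** For nonnegative functions, whose mean value may be infinite. *)
Definition emean g x r : \bar R :=
  ((fine (leb (eball x r)))^-1%:E * \int[leb]_(y in eball x r) g y)%E.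

Definition locally_integrable_rV f :=
  measurable_fun setT (f : lebesgue_rV R n -> R) /\
  forall K : set 'rV[R]_n, compact K ->
    (\int[leb]_(x in K) `|f x|%:E < +oo)%E.

(** Supremum of a set of nonnegative values, equal to 0 on the empty set
    (where [ereal_sup] is -oo). *)
Definition nneg_sup (S : set (\bar R)) : \bar R := ereal_sup (0%E |` S).

Definition reverse_Holder (q : R) f :=
  [/\ forall x, 0 <= f x, locally_integrable_rV f &
   exists2 C : R, 0 < C & forall x (r : R), 0 < r ->
    (poweR (emean (fun y => (f y `^ q)%:E) x r) q^-1 <=
     C%:E * emean (fun y => (f y)%:E) x r)%E].

End euclidean_balls.

Section smooth.
Context {R : realType} {n : nat}.
Implicit Types f : 'rV[R]_n -> R.

(** [iter_partial [:: i1; ...; ik] f] is d/dx_i1 ... d/dx_ik f. *)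
Definition iter_partial (s : seq 'I_n) f : 'rV[R]_n -> R :=
  foldr (fun i g => 'D_(delta_mx ord0 i) g) f s.

Definition smooth f := forall s : seq 'I_n, continuous (iter_partial s f) /\
  forall i x, derivable (iter_partial s f) x (delta_mx ord0 i).

Definition smooth_compact_support f :=
  smooth f /\ compact (closure [set x | f x != 0]).

End smooth.

Section schroedinger_spaces.
Context {R : realType} {n : nat}.
Implicit Types V f : 'rV[R]_n -> R.

(** Everything attached to L = - Delta + V depends on L only through the
    potential V, by way of this critical radius. *)
Definition critical_radius V (x : 'rV[R]_n) : \bar R :=
  ereal_sup [set r%:E | r in [set r : R | 0 < r /\
    ((r ^ (2%:Z - n%:Z))%:E * \int[leb]_(h in eball x r) (V h)%:E <= 1)%E]].

Definition mean_oscillations f : set (\bar R) :=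
  [set t | exists x (r : R), 0 < r /\
    t = emean (fun y => `|f y - mean f x r|%:E) x r].

Definition large_ball_means V f : set (\bar R) :=
  [set t | exists x (r : R), [/\ 0 < r, (critical_radius V x < r%:E)%E &
    t = emean (fun y => `|f y|%:E) x r]].

Definition BMO_L_norm V f : \bar R :=
  (nneg_sup (mean_oscillations f) + nneg_sup (large_ball_means V f))%E.

Definition BMO_L V f :=
  locally_integrable_rV f /\ (BMO_L_norm V f < +oo)%E.

Definition CMO_L V f := BMO_L V f /\
  forall d : R, 0 < d -> exists2 g : 'rV[R]_n -> R,
    smooth_compact_support g & (BMO_L_norm V (f \- g)%R < d%:E)%E.

End schroedinger_spaces.

(* Main.v *)
Require Import Defs.
From HB Require Import structures.
From mathcomp Require Import all_boot all_order all_algebra.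
From mathcomp Require Import all_classical all_reals all_analysis.
From mathcomp Require Import measurable_realfun ring lra.
Import Order.TTheory GRing.Theory Num.Theory.
Import numFieldNormedType.Exports.
Set Implicit Arguments.
Unset Strict Implicit.
Unset Printing Implicit Defensive.
Local Open Scope classical_set_scope.
Local Open Scope ring_scope.

(** Let g be a test function with BMO_L-norm of f - g below a small d. Two
    facts control the quadratic mean of f on a ball B(x, r) with
    rho(x) <= r <= sigma.

    Such a ball is far from the support of g when sigma is small, because rho
    has a positive lower bound on every bounded set ([critical_radius_ge]): for
    every level L > 0 one has V <= L + L^(1-q) V^q, and with L of order r^-2
    the first term contributes at most 1/2 to r^(2-n) int_B(x,r) V, the second
    at most a constant times r^(2q-n), since V^q is locally integrable by the
    reverse Hoelder inequality; the exponent 2q - n is positive. Around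
    B(x, r), therefore, f coincides with f - g: its mean oscillation is at most
    d on all balls, and the mean of |f| is at most d on a concentric ball of
    radius larger than rho(x).

    These are L^1 bounds, and they are turned into an L^2 bound by the
    John-Nirenberg inequality in quadratic form ([john_nirenberg_l2]), proved
    on cubes. For bounded h, let A be such that the mean of |h - c|^2 is at most
    A d^2 on every cube where the mean of |h - c| is at most d. Given such a
    cube Q and such a c, stop at the maximal dyadic subcubes where the mean of
    |h - c| exceeds 4d. They fill at most a quarter of Q; on each of them c
    differs from the right constant by a multiple of d, so the mean of
    |h - c|^2 is at most 2 A d^2 plus a multiple of d^2; and outside of them
    |h - c| <= 8d almost everywhere. Hence A may be replaced by A/2 + K with K
    depending on n only, and by iteration by 2K. Truncation removes the
    boundedness of h.

    The almost everywhere bound is the only point where differentiation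
    enters, and it needs no more than [density_half_eq0]: a set of finite
    measure that fills at most half of every dyadic cube around each of its
    points is null. As the measure is defined through countable covers by
    boxes, this is read off from an almost optimal cover. *)

(** * Covers by boxes and measurability of half-spaces *)

Section covers.
Context {R : realType} {n' : nat}.
Local Notation n := n'.+1.
Local Notation leb := (@leb R n).
Local Notation lebesgue_outer := (@lebesgue_outer R n).
Implicit Types (A : set 'rV[R]_n) (Q : 'rV[R]_n * 'rV[R]_n).
Local Open Scope ereal_scope.

Lemma lebesgue_outer_box_le Q : lebesgue_outer (box Q) <= (box_vol Q)%:E.
Proof.
apply: ereal_inf_lbound; exists [set Q].
  by split; [exact: countable1|move=> x Qx; exists Q].
by rewrite esum_set1// lee_fin box_vol_ge0.
Qed.

Lemma lebesgue_outer_le_cover A (F : ('rV[R]_n * 'rV[R]_n)^nat) :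
  A `<=` \bigcup_k box (F k) ->
  lebesgue_outer A <= \sum_(k <oo) (box_vol (F k))%:E.
Proof.
move=> AF; apply: (le_trans (le_lebesgue_outer AF)).
apply: (le_trans (lebesgue_outer_sigma_subadditive _)).
apply: lee_nneseries => k *; last exact: lebesgue_outer_box_le.
exact: lebesgue_outer_ge0.
Qed.

(** Covers are countable sets of boxes; sequences are easier to transform box by
    box, which is how every estimate of the outer measure below proceeds. *)
Lemma lebesgue_outer_lt_cover A x : lebesgue_outer A < x ->
  exists2 F : ('rV[R]_n * 'rV[R]_n)^nat, A `<=` \bigcup_k box (F k) &
    \sum_(k <oo) (box_vol (F k))%:E < x.
Proof.
move=> /ereal_inf_lt[_ [F [cF AF] <-] Fx].
have /countable_bijP[B /card_esym /card_set_bijP[g bg]] := cF.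
(* a box without volume fills the positions outside the enumeration *)
pose G k : 'rV[R]_n * 'rV[R]_n := if k \in B then g k else (0, 0)%R.
have G0 k : k \notin B -> box_vol (G k) = 0%R.
  move=> /negbTE kB; rewrite /G kB /box_vol big_ord_recl /= !mxE subrr.
  by rewrite maxxx mul0r.
exists G.
  move=> y /AF[Q FQ Qy]; have [_ _ /(_ _ FQ)[k Bk kQ]] := bg.
  by exists k => //; rewrite /G mem_set// kQ.
rewrite nneseries_esumT; last by move=> k; rewrite lee_fin box_vol_ge0.
rewrite (_ : \esum_(_ in _) _ = \esum_(k in B) (box_vol (g k))%:E).
  by rewrite -(@reindex_esum _ _ _ _ _ _ (fun Q => (box_vol Q)%:E) bg).
rewrite [RHS]esum_mkcond; apply: eq_esum => k _.
by case: ifPn => [kB|/G0 ->//]; rewrite /G kB.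
Qed.

(** A hyperplane cuts a box into two boxes with additive volumes; this is the
    whole content of the measurability of half-spaces. *)
Lemma box_vol_split Q (i : 'I_n) (t : R) :
  (box_vol (Q.1, \row_j (if j == i then Num.min (Q.2 ord0 j) t else Q.2 ord0 j)) +
   box_vol (\row_j (if j == i then Num.max (Q.1 ord0 j) t else Q.1 ord0 j), Q.2)
   = box_vol Q)%R.
Proof.
have vol_i Q' : box_vol Q' = (Num.max 0 (Q'.2 ord0 i - Q'.1 ord0 i) *
    \prod_(j < n | j != i) Num.max 0 (Q'.2 ord0 j - Q'.1 ord0 j))%R.
  by rewrite /box_vol (bigD1 i).
have eq_off (Q' : 'rV[R]_n * 'rV[R]_n) :
    (forall j, j != i -> Q'.1 ord0 j = Q.1 ord0 j) ->
    (forall j, j != i -> Q'.2 ord0 j = Q.2 ord0 j) ->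
    (\prod_(j < n | j != i) Num.max 0 (Q'.2 ord0 j - Q'.1 ord0 j) =
     \prod_(j < n | j != i) Num.max 0 (Q.2 ord0 j - Q.1 ord0 j))%R.
  by move=> h1 h2; apply: eq_bigr => j ji; rewrite h1 ?h2.
rewrite !vol_i eq_off; last 2 first.
- by [].
- by move=> j /negbTE ji; rewrite mxE ji.
rewrite [X in (_ + _ * X)%R]eq_off; last 2 first.
- by move=> j /negbTE ji; rewrite mxE ji.
- by [].
rewrite -mulrDl; congr (_ * _)%R; rewrite !mxE eqxx.
move: (Q.1 ord0 i) (Q.2 ord0 i) => a b; clear.
by case: (leP b t) => ?; case: (leP a t) => ?; do ![case: leP => ?]; lra.
Qed.

Lemma measurable_halfspace (i : 'I_n) (t : R) :
  measurable ([set x | x ord0 i <= t]%R : set (lebesgue_rV R n)).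
Proof.
apply: le_caratheodory_measurable => X.
apply/lee_addgt0Pr => e e0.
rewrite -[leRHS]/(lebesgue_outer X + e%:E).
have [Xoo|Xoo] := eqVneq (lebesgue_outer X) +oo.
  by rewrite Xoo addye// leey.
have : lebesgue_outer X < lebesgue_outer X + e%:E.
  by rewrite lteDl ?lte_fin// ge0_fin_numE ?lebesgue_outer_ge0// ltey.
move=> /lebesgue_outer_lt_cover[F XF /ltW FX].
apply: le_trans FX.
rewrite (_ : \sum_(_ <oo) _ =
  \sum_(k <oo) (box_vol ((F k).1, \row_j (if j == i then Num.min ((F k).2 ord0 j) t
                                    else (F k).2 ord0 j))%R)%:E +
  \sum_(k <oo) (box_vol (\row_j (if j == i then Num.max ((F k).1 ord0 j) t
                                    else (F k).1 ord0 j), (F k).2)%R)%:E).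
  apply: leeD; apply: lebesgue_outer_le_cover => x [Xx /= xt].
    have [k _ Fx] := XF _ Xx; exists k => // j; have /andP[? ?] := Fx j.
    by rewrite !mxE; case: eqP => [ji|//]; subst j; rewrite /= le_min; apply/and3P.
  have [k _ Fx] := XF _ Xx; exists k => // j; have /andP[h1 h2] := Fx j.
  rewrite !mxE; case: eqP => [ji|_]; last by apply/andP.
  subst j; rewrite /= gt_max h1 h2 !andbT /= ltNge; exact/negP.
rewrite -nneseriesD; last 2 first.
  by move=> k _; rewrite lee_fin box_vol_ge0.
  by move=> k _; rewrite lee_fin box_vol_ge0.
by apply: eq_eseriesr => k _; rewrite -EFinD box_vol_split.
Qed.

Lemma measurable_coord (i : 'I_n) :
  measurable_fun setT (fun x : lebesgue_rV R n => (x : 'rV[R]_n) ord0 i).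
Proof.
apply: (measurability _ (RGenOInfty.measurableE R)) => // _ [_ [t ->] <-].
rewrite setTI (_ : _ @^-1` _ = ~` [set x : 'rV[R]_n | x ord0 i <= t]%R).
  by apply: measurableC; exact: measurable_halfspace.
by apply/seteqP; split => x /=; rewrite in_itv/= andbT ltNge => /negP.
Qed.

End covers.

(** * Scaling of the volume of cubes *)

Section cubes.
Context {R : realType} {n' : nat}.
Local Notation n := n'.+1.
Local Notation leb := (@leb R n).
Local Notation lebesgue_outer := (@lebesgue_outer R n).
Implicit Types (A : set 'rV[R]_n) (p x : 'rV[R]_n) (s l : R).

Lemma measurable_box (Q : 'rV[R]_n * 'rV[R]_n) :
  measurable (box Q : set (lebesgue_rV R n)).
Proof.
rewrite (_ : box Q = \bigcap_(i in [set: 'I_n])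
    ((~` [set x | x ord0 i <= Q.1 ord0 i]) `&` [set x | x ord0 i <= Q.2 ord0 i])).
  apply: (@fin_bigcap_measurable _ (lebesgue_rV R n)) => // i _.
  apply: measurableI; last exact: measurable_halfspace.
  by apply: measurableC; exact: measurable_halfspace.
apply/seteqP; split => [x Qx i _|x Qx i].
  by have /andP[h1 h2] := Qx i; split => //=; apply/negP; rewrite -ltNge.
by have [/= /negP + h2] := Qx i I; rewrite -ltNge => h1; apply/andP.
Qed.

Definition cube p s : set 'rV[R]_n := box (p, \row_i (p ord0 i + s)).

(** Scaling reduces the volume of every cube to this one, and its positivity to
    the fact that the whole space is not a null set. *)
Definition unit_vol : R := fine (leb (cube 0 1)).

Lemma cubeP p s x : cube p s x <-> forall i, p ord0 i < x ord0 i <= p ord0 i + s.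
Proof. by split => h i; move: (h i); rewrite /= !mxE. Qed.

Lemma lebesgue_outer_dilation_le p l A : 0 < l ->
  (lebesgue_outer [set (p + l *: x)%R | x in A] <= (l ^+ n)%:E * lebesgue_outer A)%E.
Proof.
move=> l0; have ln0 : 0 < l ^+ n by rewrite exprn_gt0.
rewrite -lee_pdivrMl// leNgt; apply/negP => /lebesgue_outer_lt_cover[F AF].
apply/negP; rewrite -leNgt lee_pdivrMl//.
rewrite -nneseriesZl; last by move=> k; rewrite lee_fin box_vol_ge0.
rewrite (eq_eseriesr (g := fun k =>
  (box_vol (p + l *: (F k).1, p + l *: (F k).2))%:E)).
  apply: lebesgue_outer_le_cover => _ [x Ax <-].
  have [k _ Fx] := AF _ Ax; exists k => // i /=; rewrite !mxE ltrD2l lerD2l.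
  by rewrite ltr_pM2l// ler_pM2l.
move=> k _; rewrite -EFinM; congr EFin; rewrite /box_vol /=.
rewrite -[X in l ^+ X]card_ord -prodr_const -big_split/=.
apply: eq_bigr => i _; rewrite !mxE opprD addrACA subrr add0r -mulrBr.
by rewrite maxr_pMr ?mulr0 ?ltW.
Qed.

Lemma lebesgue_outer_unit_cube_le1 : (lebesgue_outer (cube 0 1) <= 1)%E.
Proof.
apply: le_trans (lebesgue_outer_box_le _) _; rewrite /box_vol /=.
rewrite big1// => i _; rewrite !mxE add0r subr0 max_r//.
Qed.

Lemma leb_unit_cube : leb (cube 0 1) = unit_vol%:E.
Proof.
rewrite fineK// ge0_fin_numE ?lebesgue_outer_ge0//.
by apply: le_lt_trans lebesgue_outer_unit_cube_le1 _; rewrite ltry.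
Qed.

Lemma unit_vol_ge0 : 0 <= unit_vol.
Proof. exact/fine_ge0/lebesgue_outer_ge0. Qed.

Lemma cube_dilation p l q s : 0 < l ->
  cube (p + l *: q) (l * s) = [set p + l *: x | x in cube q s].
Proof.
move=> l0; apply/seteqP; split => [x /cubeP qx|_ [x /cubeP qx <-]].
  exists (l^-1 *: (x - p)); last first.
    by rewrite scalerA divff ?gt_eqF// scale1r addrC subrK.
  apply/cubeP => i; have := qx i; rewrite !mxE => /andP[h1 h2].
  by rewrite ltr_pdivlMl// ler_pdivrMl// ltrBrDl h1 mulrDr lerBlDl addrA.
apply/cubeP => i; have := qx i; rewrite !mxE -addrA ltrD2l lerD2l => /andP[h1 h2].
by rewrite ltr_pM2l// h1 -mulrDr ler_pM2l.
Qed.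

(** Dilating by s and by 1/s gives the two inequalities. *)
Lemma leb_cube p s : 0 < s -> leb (cube p s) = (unit_vol * s ^+ n)%:E.
Proof.
move=> s0; apply/eqP; rewrite eq_le; apply/andP; split.
  rewrite -[X in cube _ X]mulr1 -[p]addr0 -[X in p + X](scaler0 _ s).
  rewrite cube_dilation//; apply: le_trans (lebesgue_outer_dilation_le _ _ s0) _.
  by rewrite -[lebesgue_outer _]/(leb (cube 0 1)) leb_unit_cube -EFinM mulrC.
rewrite mulrC EFinM -lee_pdivlMl ?exprn_gt0// -leb_unit_cube -exprVn.
rewrite (_ : cube 0 1 = cube (- (s^-1 *: p) + s^-1 *: p) (s^-1 * s)).
  by rewrite cube_dilation ?invr_gt0// lebesgue_outer_dilation_le ?invr_gt0.
by rewrite mulVf ?gt_eqF// addNr.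
Qed.

(** If the unit cube were null, so would be the whole space, a countable union
    of cubes. *)
Lemma unit_vol_gt0_of_setT : leb setT != 0%E -> 0 < unit_vol.
Proof.
rewrite lt_neqAle unit_vol_ge0 andbT; apply: contra => /eqP w0; apply/eqP.
apply/eqP; rewrite eq_le lebesgue_outer_ge0 andbT.
pose C k : set 'rV[R]_n := cube (const_mx (- k.+1%:R)) (k.+1%:R *+ 2).
have TC : [set: 'rV[R]_n] `<=` \bigcup_k C k.
  move=> x _; pose M := \sum_i `|x ord0 i|.
  have xM i : `|x ord0 i| <= M.
    by rewrite /M (bigD1 i)//= lerDl sumr_ge0.
  have [k Mk] : exists k, M < k.+1%:R.
    exists (Num.truncn M); exact: truncnS_gt.
  exists k => //; apply/cubeP => i; rewrite mxE mulr2n addrA addNr add0r.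
  have := le_lt_trans (xM i) Mk; rewrite ltr_norml => /andP[-> /ltW ->] //.
apply: (le_trans (le_lebesgue_outer TC)).
apply: (le_trans (lebesgue_outer_sigma_subadditive _)).
rewrite eseries0// => k _ _; rewrite -[LHS]/(leb (C k)) leb_cube ?mulrn_wgt0//.
by rewrite -w0 mul0r.
Qed.

End cubes.

(** * Dyadic cubes and stopping families *)

Section dyadic.
Context {R : realType} {n' : nat}.
Local Notation n := n'.+1.
Local Notation leb := (@leb R n).
Local Notation unit_vol := (@unit_vol R n').
Variables (p : 'rV[R]_n) (s : R).
Hypothesis s_gt0 : 0 < s.
Implicit Types (x y : 'rV[R]_n) (z : 'rV[int]_n) (k : nat).

Definition side k : R := s / 2 ^+ k.

Lemma side_gt0 k : 0 < side k.
Proof. by rewrite divr_gt0// exprn_gt0. Qed.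

Lemma sideS k : side k = side k.+1 * 2.
Proof. by rewrite /side exprSr invfM mulrA divfK. Qed.

Lemma side_small (d : R) : 0 < d -> exists k, side k <= d.
Proof.
move=> d0; exists (Num.truncn (s / d)).+1.
rewrite ler_pdivrMr ?exprn_gt0// mulrC -ler_pdivrMr//.
apply: (le_trans (ltW (truncnS_gt _))).
by rewrite -natrX ler_nat ltnW// ltn_expl.
Qed.

(** The cubes are half-open on the left, like boxes, so that ceilings give the
    index of the unique cube of generation k that contains a point. *)
Definition dyadic_index k x : 'rV[int]_n :=
  \row_i Num.ceil ((x ord0 i - p ord0 i) / side k).

Definition dyadic_corner k z : 'rV[R]_n :=
  \row_i (p ord0 i + side k * (z ord0 i - 1)%:~R).

Definition dyadic_cube k z : set 'rV[R]_n := cube (dyadic_corner k z) (side k).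

Lemma dyadic_cubeP k z x : dyadic_cube k z x <-> dyadic_index k x = z.
Proof.
have E i : ((dyadic_corner k z) ord0 i < x ord0 i <=
     (dyadic_corner k z) ord0 i + side k) =
    (Num.ceil ((x ord0 i - p ord0 i) / side k) == z ord0 i).
  rewrite ceil_eq ltr_pdivlMr ?side_gt0// ler_pdivrMr ?side_gt0// mxE.
  rewrite ltrBrDl lerBlDl [_ * side k]mulrC -addrA [_%:~R * side k]mulrC.
  by rewrite intrB mulrBr mulr1 subrK.
split=> [/cubeP xz|xz].
  by apply/rowP => i; rewrite mxE; apply/eqP; rewrite -E.
by apply/cubeP => i; rewrite E -xz mxE.
Qed.

Lemma dyadic_cube_index k x : dyadic_cube k (dyadic_index k x) x.
Proof. exact/dyadic_cubeP. Qed.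

Lemma dyadic_cube0 : dyadic_cube 0 (const_mx 1) = cube p s.
Proof.
rewrite /dyadic_cube /side expr0 divr1; congr (cube _ _).
by apply/rowP => i; rewrite !mxE subrr mulr0 addr0.
Qed.

(** The ceiling of t/2 is determined by the ceiling of t. *)
Lemma dyadic_indexS k x y :
  dyadic_index k.+1 x = dyadic_index k.+1 y ->
  dyadic_index k x = dyadic_index k y.
Proof.
have le_idx u v (w : 'I_n) : dyadic_index k.+1 u = dyadic_index k.+1 v ->
    (dyadic_index k u ord0 w <= dyadic_index k v ord0 w)%R.
  move=> /rowP/(_ w); rewrite !mxE => uv; rewrite ceil_le_int.
  have h t : (t - p ord0 w) / side k = (t - p ord0 w) / side k.+1 / 2.
    by rewrite (sideS k) invfM mulrA.
  rewrite !h ler_pdivrMr// -[2]/(2%:~R) -intrM -ceil_le_int uv ceil_le_int.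
  by rewrite intrM -ler_pdivrMr// ceil_ge.
by move=> h; apply/rowP => i; apply/eqP; rewrite eq_le !le_idx.
Qed.

Lemma dyadic_index_le j k x y : (j <= k)%N ->
  dyadic_index k x = dyadic_index k y -> dyadic_index j x = dyadic_index j y.
Proof.
move=> /subnK <-; elim: (k - j)%N => // m IH; rewrite addSn => h.
exact/IH/dyadic_indexS.
Qed.

Lemma dyadic_cube_sub k x : cube p s x ->
  dyadic_cube k (dyadic_index k x) `<=` cube p s.
Proof.
rewrite -dyadic_cube0 => /dyadic_cubeP <- y /dyadic_cubeP yx.
by apply/dyadic_cubeP; apply: dyadic_index_le yx.
Qed.

Lemma dyadic_cube_parent k x :
  dyadic_cube k.+1 (dyadic_index k.+1 x) `<=` dyadic_cube k (dyadic_index k x).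
Proof. by move=> y /dyadic_cubeP/dyadic_indexS yx; exact/dyadic_cubeP. Qed.

Lemma measurable_dyadic_cube k z :
  measurable (dyadic_cube k z : set (lebesgue_rV R n)).
Proof. exact: measurable_box. Qed.

Lemma leb_dyadic_cube k z :
  leb (dyadic_cube k z) = (unit_vol * side k ^+ n)%:E.
Proof. by rewrite leb_cube ?side_gt0. Qed.

(** Keep, for each point where P holds at some generation, the cube of the
    first such generation. Two kept cubes that meet are equal because dyadic
    cubes are nested, and the family is countable because generations and
    indices are. *)
Lemma dyadic_stopping (P : nat -> 'rV[int]_n -> Prop) :
  exists (D : set nat) (l : nat -> nat) (z : nat -> 'rV[int]_n),
  [/\ trivIset D (fun m => dyadic_cube (l m) (z m)),
      forall m, D m -> P (l m) (z m),
      forall m j x, D m -> (j < l m)%N -> dyadic_cube (l m) (z m) x ->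
        ~ P j (dyadic_index j x) &
      forall k x, P k (dyadic_index k x) ->
        exists2 m, D m & dyadic_cube (l m) (z m) x].
Proof.
pose kz (m : nat) : nat * 'rV[int]_n := odflt (0%N, 0) (unpickle m).
pose D := [set m | pickle (kz m) = m /\ P (kz m).1 (kz m).2 /\
  forall j x, (j < (kz m).1)%N -> dyadic_cube (kz m).1 (kz m).2 x ->
        ~ P j (dyadic_index j x)].
have Dlt m m' x : D m -> D m' -> dyadic_cube (kz m).1 (kz m).2 x ->
    dyadic_cube (kz m').1 (kz m').2 x -> ((kz m).1 <= (kz m').1)%N.
  move=> [_ [_ mD]] [_ [Pm' _]] xm /dyadic_cubeP xm'.
  rewrite leqNgt; apply/negP => /mD/(_ xm); apply.
  by rewrite xm'.
exists D, (fun m => (kz m).1), (fun m => (kz m).2); split.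
- move=> m m' Dm Dm' [x [xm xm']].
  have kk : (kz m).1 = (kz m').1 by apply/eqP; rewrite eqn_leq !(Dlt _ _ x).
  rewrite -Dm.1 -Dm'.1; congr pickle; apply: injective_projections => //.
  by move/dyadic_cubeP : xm => <-; rewrite kk; apply/dyadic_cubeP.
- by move=> m [_ []].
- by move=> m j x [_ [_ h]] /h; exact.
move=> k x Pk; have exk : exists k, `[< P k (dyadic_index k x) >].
  by exists k; exact/asboolP.
have [{Pk}k /asboolP Pk kmin] := ex_minnP exk.
exists (pickle (k, dyadic_index k x)); last first.
  by rewrite /kz pickleK/=; exact: dyadic_cube_index.
rewrite /D /kz /= pickleK/=; split => //; split => // j y jk.
move=> /dyadic_cubeP/(dyadic_index_le (ltnW jk)) -> Pj.
by have := kmin j; rewrite leqNgt jk => h; have := h (introT (asboolP _) Pj).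
Qed.

End dyadic.

(** * A weak form of the density theorem *)

Section density.
Context {R : realType} {n' : nat}.
Local Notation n := n'.+1.
Local Notation leb := (@leb R n).
Local Notation lebesgue_outer := (@lebesgue_outer R n).

(** By convexity the graph of (1 + e)^k on [0, 1] lies below its chord. *)
Lemma bernoulli_converse (e : R) k : 0 <= e -> e <= 1 ->
  (1 + e) ^+ k <= 1 + (2 ^+ k - 1) * e.
Proof.
move=> e0 e1; elim: k => [|k IH]; first by rewrite !expr0 subrr mul0r addr0.
rewrite exprS; apply: (le_trans (ler_wpM2l _ IH)); first by rewrite addr_ge0.
rewrite (exprS 2); have : 1 <= 2 ^+ k :> R by rewrite exprn_ege1// ler1n.
move: (2 ^+ k) => c c1.
have : 0 <= (c - 1) * (e * (1 - e)) by rewrite !mulr_ge0// subr_ge0.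
lra.
Qed.

(** Boxes are closed on the upper side only; a slight stretch makes room for a
    dyadic cube around each of their points. *)
Lemma box_vol_stretch (Q : 'rV[R]_n * 'rV[R]_n) (e : R) : 0 <= e ->
  box_vol (Q.1, Q.2 + e *: (Q.2 - Q.1)) = (1 + e) ^+ n * box_vol Q.
Proof.
move=> e0; rewrite /box_vol -[X in _ ^+ X]card_ord -prodr_const -big_split/=.
apply: eq_bigr => i _; rewrite !mxE.
rewrite (_ : _ - _ = (1 + e) * (Q.2 ord0 i - Q.1 ord0 i)); last by ring.
by rewrite maxr_pMr ?mulr0// addr_ge0.
Qed.

Lemma box_dyadic_cube_sub (p : 'rV[R]_n) (s : R) (Q : 'rV[R]_n * 'rV[R]_n)
    (e : R) x : 0 < s -> 0 < e -> e <= 1 -> box Q x ->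
  exists k, dyadic_cube p s k (dyadic_index p s k x) `<=`
            box (Q.1, Q.2 + e *: (Q.2 - Q.1)).
Proof.
move=> s0 e0 e1 Qx.
pose d := \big[Num.min/1]_i (x ord0 i - Q.1 ord0 i).
have d0 : 0 < d.
  by apply/bigmin_gtP; split=> // i _; rewrite subr_gt0; case/andP: (Qx i).
(* a side of at most e d keeps the cube above the lower faces, since e <= 1,
   and below the stretched upper faces, since d is at most every edge *)
have [k ked] := side_small s (mulr_gt0 e0 d0).
exists k => y /cubeP xy i; have /cubeP/(_ i) xx := dyadic_cube_index p s0 k x.
move: xy xx => /(_ i); set c := dyadic_corner _ _ _ _ ord0 i; rewrite /= !mxE.
have : d <= x ord0 i - Q.1 ord0 i by exact: bigmin_le_cond.
have /andP[] := Qx i; move: ked d0.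
move: (side s k) (x ord0 i) (y ord0 i) (Q.1 ord0 i) (Q.2 ord0 i) => t u v a b.
by clear -e0 e1; move=> *; apply/andP; split; nra.
Qed.

(** Otherwise take a cover of G by boxes with total volume close to the measure
    of G, and stretch the boxes. The first dyadic cubes that fit in a stretched
    box are disjoint and cover G, which fills at most half of each: the measure
    of G is at most half the volume of a cover that is nearly optimal. *)
Lemma density_half_eq0 (p : 'rV[R]_n) (s : R) (G : set (lebesgue_rV R n)) :
  0 < s -> measurable G -> (leb G < +oo)%E ->
  (forall x k, G x ->
    (leb (G `&` dyadic_cube p s k (dyadic_index p s k x)) <=
     2^-1%:E * leb (dyadic_cube p s k (dyadic_index p s k x)))%E) ->
  leb G = 0%E.
Proof.
move=> s0 mG Goo Gx; apply: contrapT => /eqP G_neq0.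
have Gfin : leb G \is a fin_num by rewrite ge0_fin_numE ?lebesgue_outer_ge0.
pose g := fine (leb G).
have Eg : leb G = g%:E by rewrite fineK.
have g0 : 0 < g.
  by rewrite -lte_fin -Eg lt_neqAle eq_sym G_neq0 lebesgue_outer_ge0.
have : (lebesgue_outer G < (3 / 2 * g)%:E)%E.
  by rewrite -[lebesgue_outer G]/(leb G) Eg lte_fin; lra.
move=> /lebesgue_outer_lt_cover[F GF Fg].
(* the cover costs a factor 3/2 and the stretch by e a factor 5/4; all that
   matters is that their product 15/8 stays below 2 *)
pose e : R := (4 * 2 ^+ n)^-1.
have e0 : 0 < e by rewrite invr_gt0 mulr_gt0// exprn_gt0.
have c1 : 1 <= 2 ^+ n :> R by rewrite exprn_ege1// ler1n.
have e1 : e <= 1 by rewrite invf_le1 ?mulr_gt0 ?exprn_gt0//; lra.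
have e54 : (1 + e) ^+ n <= 5 / 4.
  apply: (le_trans (bernoulli_converse _ (ltW e0) e1)).
  have : 2 ^+ n * e = 4^-1.
    by rewrite /e invfM mulrCA divff ?mulr1// gt_eqF// exprn_gt0.
  lra.
pose F' k := ((F k).1, (F k).2 + e *: ((F k).2 - (F k).1)).
pose U := \bigcup_k box (F' k).
have mU : measurable (U : set (lebesgue_rV R n)).
  by apply: bigcup_measurable => k _; exact: measurable_box.
have Ug : (leb U <= (15 / 8 * g)%:E)%E.
  apply: (@le_trans _ _ (\sum_(k <oo) (box_vol (F' k))%:E)%E).
    exact: lebesgue_outer_le_cover.
  rewrite (eq_eseriesr (g := fun k => ((1 + e) ^+ n)%:E * (box_vol (F k))%:E)%E).
    rewrite nneseriesZl; last by move=> k _; rewrite lee_fin box_vol_ge0.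
    apply: (@le_trans _ _ ((5 / 4)%:E * (3 / 2 * g)%:E)%E).
      apply: lee_pmul; last exact: ltW.
      - by rewrite lee_fin exprn_ge0// addr_ge0// ltW.
      - by apply: nneseries_ge0 => k _ _; rewrite lee_fin box_vol_ge0.
      - by rewrite lee_fin.
    by rewrite -EFinM lee_fin; lra.
  by move=> k _; rewrite -EFinM box_vol_stretch// ltW.
pose P k z := dyadic_cube p s k z `<=` U /\
  exists2 x, G x & dyadic_index p s k x = z.
have [D [l [z [tD DP _ coverP]]]] := dyadic_stopping p s0 P.
pose C m : set (lebesgue_rV R n) := dyadic_cube p s (l m) (z m).
have mC m : measurable (C m) by exact: measurable_dyadic_cube.
have GE : G = \bigcup_(m in D) (G `&` C m).
  apply/seteqP; split => [x Gx'|x [m _ []]//].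
  have [j _ Fx] := GF _ Gx'.
  have [k kU] := box_dyadic_cube_sub p s0 e0 e1 Fx.
  have [m Dm Cx] : exists2 m, D m & C m x.
    apply: (coverP k); split; last by exists x.
    by move=> y /kU; exists j.
  by exists m.
suff : (g%:E <= 2^-1%:E * (15 / 8 * g)%:E)%E.
  by rewrite -EFinM lee_fin; lra.
rewrite -Eg {1}GE measure_bigcup//; last 2 first.
- by move=> m Dm; exact: measurableI.
- by move=> i j Di Dj [y [[_ yi] [_ yj]]]; apply: tD => //; exists y.
apply: (@le_trans _ _ (\sum_(m <oo | m \in D) (2^-1%:E * leb (C m)))%E).
  apply: lee_nneseries => m; first by move=> _ _; exact: lebesgue_outer_ge0.
  by rewrite inE => /DP[_ [x Gx' xz]]; rewrite /C -xz; exact: Gx.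
rewrite nneseriesZl; last by move=> m _; exact: lebesgue_outer_ge0.
rewrite lee_pmul2l// -measure_bigcup//.
apply: le_trans Ug; apply: le_lebesgue_outer => x [m Dm]; exact: (DP m Dm).1.
Qed.

End density.

(** * Integrals of nonnegative real functions *)

Section real_integrands.
Context d (T : measurableType d) (R : realType) (mu : {measure set T -> \bar R}).
Variable D : set T.
Hypothesis mD : measurable D.
Implicit Types F G : T -> R.
Local Open Scope ereal_scope.

Lemma integral_EFin_le F G :
  measurable_fun setT F -> measurable_fun setT G ->
  (forall y, 0 <= F y)%R -> (forall y, D y -> F y <= G y)%R ->
  \int[mu]_(y in D) (F y)%:E <= \int[mu]_(y in D) (G y)%:E.
Proof.
move=> mF mG F0 FG; apply: (ge0_le_integral mu mD).
- by move=> y _; rewrite lee_fin.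
- by apply/measurable_EFinP; exact: measurable_funTS.
- by apply/measurable_EFinP; exact: measurable_funTS.
- by move=> y Dy; rewrite lee_fin FG.
Qed.

Lemma integral_EFinD F G :
  measurable_fun setT F -> measurable_fun setT G ->
  (forall y, 0 <= F y)%R -> (forall y, 0 <= G y)%R ->
  \int[mu]_(y in D) (F y + G y)%:E =
  \int[mu]_(y in D) (F y)%:E + \int[mu]_(y in D) (G y)%:E.
Proof.
move=> mF mG F0 G0; under eq_integral do rewrite EFinD.
apply: (ge0_integralD mu mD).
- by move=> y _; rewrite lee_fin.
- by apply/measurable_EFinP; exact: measurable_funTS.
- by move=> y _; rewrite lee_fin.
- by apply/measurable_EFinP; exact: measurable_funTS.
Qed.

Lemma integral_EFinZ (a : R) F :
  measurable_fun setT F -> (forall y, 0 <= F y)%R -> (0 <= a)%R ->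
  \int[mu]_(y in D) (a * F y)%:E = a%:E * \int[mu]_(y in D) (F y)%:E.
Proof.
move=> mF F0 a0; under eq_integral do rewrite EFinM.
apply: (ge0_integralZl_EFin mu mD) => //.
- by move=> y _; rewrite lee_fin.
- by apply/measurable_EFinP; exact: measurable_funTS.
Qed.

Lemma integral_EFin_cst (a : R) :
  \int[mu]_(y in D) a%:E = a%:E * mu D.
Proof. exact: integral_cst. Qed.

Lemma integral_EFin_subset F (E : set T) : measurable E ->
  measurable_fun setT F -> (forall y, 0 <= F y)%R -> E `<=` D ->
  \int[mu]_(y in E) (F y)%:E <= \int[mu]_(y in D) (F y)%:E.
Proof.
move=> mE mF F0 ED; apply: ge0_subset_integral => //.
  by apply/measurable_EFinP; exact: measurable_funTS.
by move=> y _; rewrite lee_fin.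
Qed.

End real_integrands.

(** * Deviation from a constant on cubes *)

Section deviation.
Context {R : realType} {n' : nat}.
Local Notation n := n'.+1.
Local Notation leb := (@leb R n).
Local Notation unit_vol := (@unit_vol R n').
Implicit Types (h : lebesgue_rV R n -> R) (p : 'rV[R]_n) (s c : R).

Definition cube_vol s : R := unit_vol * s ^+ n.

Definition l1dev h p s c : \bar R := (\int[leb]_(y in cube p s) `|h y - c|%:E)%E.

Definition l2dev h p s c : \bar R :=
  (\int[leb]_(y in cube p s) (`|h y - c| ^+ 2)%:E)%E.

Hypothesis unit_vol_gt0 : 0 < unit_vol.

Lemma cube_vol_gt0 s : 0 < s -> 0 < cube_vol s.
Proof. by move=> s0; rewrite mulr_gt0 ?exprn_gt0. Qed.

Lemma measurable_cube p s : measurable (cube p s : set (lebesgue_rV R n)).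
Proof. exact: measurable_box. Qed.

Section measurable_function.
Variable h : lebesgue_rV R n -> R.
Hypothesis mh : measurable_fun setT h.

Lemma measurable_dev c : measurable_fun setT (fun y => `|h y - c|).
Proof.
apply: measurableT_comp; first exact: normr_measurable.
exact: measurable_funB.
Qed.

Lemma measurable_dev_sqr c : measurable_fun setT (fun y => `|h y - c| ^+ 2).
Proof. by apply: measurable_funX; exact: measurable_dev. Qed.

(** Admissible constants are almost unique; this controls the change of constant
    from a cube to a subcube in the stopping argument. *)
Lemma l1dev_const_le p s c c' a b : 0 < s ->
  (l1dev h p s c <= (a * cube_vol s)%:E)%E ->
  (l1dev h p s c' <= (b * cube_vol s)%:E)%E -> `|c - c'| <= a + b.
Proof.
move=> s0 ha hb; rewrite -(ler_pM2r (cube_vol_gt0 s0)) -lee_fin mulrDl EFinD.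
have mc := measurable_cube p s; have mdev := measurable_dev.
apply: le_trans (leeD ha hb); rewrite EFinM -(leb_cube p s0).
rewrite -(integral_EFin_cst leb mc) -(integral_EFinD leb mc (mdev c) (mdev c'))//.
apply: (integral_EFin_le leb mc (measurable_cst _)
  (measurable_funD (mdev c) (mdev c'))) => [y|y _] /=; first exact: normr_ge0.
by rewrite (distrC (h y)) ler_distD.
Qed.

Lemma l2dev_change_center p s c c' : 0 < s ->
  (l2dev h p s c' <=
   2%:E * l2dev h p s c + (2 * `|c - c'| ^+ 2 * cube_vol s)%:E)%E.
Proof.
move=> s0; rewrite [in leRHS]EFinM -(leb_cube p s0).
have mc := measurable_cube p s.
have dev0 a y : 0 <= `|h y - a| ^+ 2 by rewrite exprn_ge0.
have mdev2 : measurable_fun setT (fun y => 2 * `|h y - c| ^+ 2).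
  exact: (measurable_funM (measurable_cst _) (measurable_dev_sqr c)).
rewrite -(integral_EFin_cst leb mc).
rewrite -(integral_EFinZ leb mc (measurable_dev_sqr c))//.
rewrite -(integral_EFinD leb mc mdev2 (measurable_cst _)); last 2 first.
- by move=> y; rewrite mulr_ge0.
- by move=> y /=; rewrite mulr_ge0.
apply: (integral_EFin_le leb mc (measurable_dev_sqr c')
  (measurable_funD mdev2 (measurable_cst _))) => // y _.
rewrite /= !real_normK ?num_real//.
rewrite -[leRHS]/(2 * (h y - c) ^+ 2 + 2 * (c - c') ^+ 2).
by have := sqr_ge0 (h y - c - (c - c')); lra.
Qed.

End measurable_function.
End deviation.

(** * The John-Nirenberg inequality in quadratic form *)

Section john_nirenberg.
Context {R : realType} {n' : nat}.
Local Notation n := n'.+1.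
Local Notation leb := (@leb R n).
Local Notation unit_vol := (@unit_vol R n').
Local Notation cube_vol := (@cube_vol R n').
Hypothesis unit_vol_gt0 : 0 < unit_vol.
Variable h : lebesgue_rV R n -> R.
Hypothesis mh : measurable_fun setT h.
Implicit Types (p : 'rV[R]_n) (s c d A : R).

(** Bounded mean oscillation on the subcubes of a cube. The constant is not
    required to be the mean, so that the property passes to truncations. *)
Definition l1dev_small d p0 s0 := forall p s, 0 < s -> cube p s `<=` cube p0 s0 ->
  exists c, (l1dev h p s c <= (d * cube_vol s)%:E)%E.

(** The property that improves itself. It speaks of all admissible constants on
    all subcubes because the stopping argument leads to other cubes and other
    constants. *)
Definition l2dev_bounded d A p0 s0 := forall p s c, 0 < s ->
  cube p s `<=` cube p0 s0 -> (l1dev h p s c <= (d * cube_vol s)%:E)%E ->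
  (l2dev h p s c <= (A * d ^+ 2 * cube_vol s)%:E)%E.

Lemma l1dev_parent d p s c (k : nat) x (lam : R) : 0 < s -> 0 <= lam ->
  (l1dev h (dyadic_corner p s k (dyadic_index p s k x)) (side s k) c <=
     (lam * cube_vol (side s k))%:E)%E ->
  (l1dev h (dyadic_corner p s k.+1 (dyadic_index p s k.+1 x)) (side s k.+1) c <=
     (2 ^+ n * lam * cube_vol (side s k.+1))%:E)%E.
Proof.
move=> s0 lam0 hk.
rewrite (_ : 2 ^+ n * _ * _ = lam * cube_vol (side s k)); last first.
  by rewrite /cube_vol (sideS s k) [(_ * 2) ^+ n]exprMn; ring.
apply: le_trans hk; apply: integral_EFin_subset.
- exact: measurable_cube.
- exact: measurable_cube.
- exact: measurable_dev.
- by [].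
- exact: dyadic_cube_parent.
Qed.

(** The two terms come from outside and from inside the stopping cubes:
    64 = (2 * 4)^2 is the square of the bound outside, and 1 + 4 * 2^n bounds,
    in units of d, the change of constant inside. *)
Definition jn_const : R := 64 + (1 + 4 * 2 ^+ n) ^+ 2 / 2.

(** The stopping argument at the level lam = 4 d. Stopping cubes have total
    volume at most d / lam = 1/4 of the cube, which yields the factor 1/2 in
    front of A after the factor 2 lost in changing the constant. *)
Lemma l2dev_bounded_improve d A p0 s0 : 0 < d -> 0 <= A ->
  l1dev_small d p0 s0 -> l2dev_bounded d A p0 s0 ->
  l2dev_bounded d (A / 2 + jn_const) p0 s0.
Proof.
move=> d0 A0 osc l2A p s c s_gt0 sQ0 l1c.
pose lam := 4 * d; have lam0 : 0 < lam by rewrite mulr_gt0.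
set Q : set (lebesgue_rV R n) := cube p s in sQ0.
have mQ : measurable (Q : set (lebesgue_rV R n)) by exact: measurable_cube.
pose F (y : lebesgue_rV R n) : R := `|h y - c|.
have mF : measurable_fun setT F by exact: measurable_dev.
have F0 y : 0 <= F y by exact: normr_ge0.
have mF2 : measurable_fun setT (fun y => F y ^+ 2) by exact: measurable_dev_sqr.
have F20 y : 0 <= F y ^+ 2 by rewrite exprn_ge0.
pose P k z := dyadic_cube p s k z `<=` Q /\
  ((lam * cube_vol (side s k))%:E <
    l1dev h (dyadic_corner p s k z) (side s k) c)%E.
have [D [l [z [tD DP Dmin Dcover]]]] := dyadic_stopping p s_gt0 P.
pose C m : set (lebesgue_rV R n) := dyadic_cube p s (l m) (z m).
pose E m : set (lebesgue_rV R n) := [set y | D m /\ C m y].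
have ED m : D m -> E m = C m.
  by move=> Dm; apply/seteqP; split => [y []//|y Cy]; split.
have END m : ~ D m -> E m = set0 by move=> Dm; apply/seteqP; split => [y []|].
have mE m : measurable (E m).
  have [Dm|Dm] := pselect (D m); last by rewrite END//; exact: measurable0.
  by rewrite ED//; exact: measurable_dyadic_cube.
have tE : trivIset setT E.
  by move=> i j _ _ [y [[Di Ciy] [Dj Cjy]]]; apply: tD => //; exists y.
pose S : set (lebesgue_rV R n) := \bigcup_m E m.
have mS : measurable S by exact: bigcup_measurable.
have SQ : S `<=` Q by move=> y [m _ [Dm Cy]]; exact: (DP m Dm).1.
pose B : R := 1 + 4 * 2 ^+ n.
have B0 : 0 <= B by rewrite addr_ge0// mulr_ge0// exprn_ge0.
pose M := (2 * A + 2 * B ^+ 2) * d / 4.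
have M0 : 0 <= M.
  by rewrite /M !mulr_ge0 ?addr_ge0 ?mulr_ge0 ?exprn_ge0 ?invr_ge0// ltW.
(* the volume of a stopping cube is traded for the integral of F on it, so
   that summing over the cubes only involves integrals *)
have l2E m : (\int[leb]_(y in E m) (F y ^+ 2)%:E <=
    M%:E * \int[leb]_(y in E m) (F y)%:E)%E.
  have [Dm|Dm] := pselect (D m); last by rewrite END// !integral_set0 mule0.
  rewrite ED//; have [CQ big] := DP m Dm.
  have t0 := side_gt0 s_gt0 (l m).
  have [c' l1c'] := osc _ _ t0 (subset_trans CQ sQ0).
  have l1c_parent : (l1dev h (dyadic_corner p s (l m) (z m)) (side s (l m)) c <=
      (2 ^+ n * lam * cube_vol (side s (l m)))%:E)%E.
    (* a stopping cube is not the whole cube, whose mean is at most d < lam; the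
       mean on its parent, which is not a stopping cube, is at most lam *)
    have [x Cx] : exists x, C m x.
      exists (dyadic_corner p s (l m) (z m) + const_mx (side s (l m))).
      by apply/cubeP => i; rewrite !mxE ltrDl lexx t0.
    have zx := (dyadic_cubeP p s_gt0 (l m) (z m) x).1 Cx.
    have Qx : Q x by exact: CQ.
    move: Cx zx big; rewrite /C; case lm : (l m) => [|k] Cx zx big.
      exfalso; move: big; apply/negP; rewrite -leNgt.
      have Q0x : dyadic_cube p s 0 (const_mx 1) x by rewrite dyadic_cube0.
      have z1 : z m = const_mx 1.
        by rewrite -zx; exact/(dyadic_cubeP p s_gt0).
      have EQ : dyadic_cube p s 0 (z m) = Q by rewrite z1 dyadic_cube0.
      rewrite /l1dev -[cube _ _]/(dyadic_cube p s 0 (z m)) EQ.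
      apply: (le_trans l1c); rewrite /side expr0 divr1 lee_fin ler_pM2r.
        by rewrite /lam; lra.
      exact: cube_vol_gt0.
    rewrite -zx; apply: l1dev_parent => //; first exact: ltW.
    rewrite leNgt; apply/negP => bigk.
    apply: (Dmin m k x) => //; first by rewrite lm.
      by rewrite lm.
    by split => //; exact: dyadic_cube_sub.
  have cc' : `|c' - c| <= B * d.
    apply: (le_trans (l1dev_const_le unit_vol_gt0 mh t0 l1c' l1c_parent)).
    by rewrite /B /lam; lra.
  apply: (le_trans (l2dev_change_center mh _ c' c t0)).
  apply: (@le_trans _ _ ((2 * A + 2 * B ^+ 2) * d ^+ 2 *
      cube_vol (side s (l m)))%:E).
    have vol0 := ltW (cube_vol_gt0 unit_vol_gt0 t0).
    apply: (@le_trans _ _ (2%:E * (A * d ^+ 2 * cube_vol (side s (l m)))%:E +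
      (2 * (B * d) ^+ 2 * cube_vol (side s (l m)))%:E)%E).
      apply: leeD.
        by apply: lee_wpmul2l; rewrite ?lee_fin//; exact: l2A (subset_trans CQ sQ0) l1c'.
      rewrite lee_fin ler_wpM2r// ler_wpM2l// lerXn2r// nnegrE//.
      by rewrite mulr_ge0// ltW.
    by rewrite -EFinM -EFinD lee_fin exprMn; lra.
  apply: (@le_trans _ _ (M%:E * (lam * cube_vol (side s (l m)))%:E)%E).
    by rewrite -EFinM lee_fin /M /lam; lra.
  by apply: lee_wpmul2l; [rewrite lee_fin|exact: ltW].
have l2S : (\int[leb]_(y in S) (F y ^+ 2)%:E <=
    ((A / 2 + B ^+ 2 / 2) * d ^+ 2 * cube_vol s)%:E)%E.
  have mSF2 : measurable_fun S (fun y => (F y ^+ 2)%:E).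
    by apply/measurable_EFinP; exact: measurable_funTS.
  have mSF : measurable_fun S (fun y => (F y)%:E).
    by apply/measurable_EFinP; exact: measurable_funTS.
  rewrite (ge0_integral_bigcup leb mE mSF2 _ tE); last first.
    by move=> y _; rewrite lee_fin.
  apply: (@le_trans _ _ (\sum_(m <oo) (M%:E * \int[leb]_(y in E m) (F y)%:E))%E).
    apply: lee_nneseries => m *; last exact: l2E.
    by apply: integral_ge0 => y _; rewrite lee_fin.
  rewrite nneseriesZl; last first.
    by move=> m _; apply: integral_ge0 => y _; rewrite lee_fin.
  rewrite -(ge0_integral_bigcup leb mE mSF _ tE); last first.
    by move=> y _; rewrite lee_fin.
  apply: (@le_trans _ _ (M%:E * (d * cube_vol s)%:E)%E).
    apply: lee_wpmul2l; rewrite ?lee_fin//; apply: le_trans l1c.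
    exact: integral_EFin_subset.
  by rewrite -EFinM lee_fin /M; lra.
pose G : set (lebesgue_rV R n) := (Q `\` S) `&` [set y | 2 * lam < F y].
have mG : measurable G.
  apply: measurableI; first exact: measurableD.
  rewrite -[X in measurable X]setTI.
  have := measurable_fun_ltr (measurable_cst (2 * lam)) mF.
  by move=> /(_ measurableT [set true] I).
have GQ : G `<=` Q by move=> y [[]].
have Goo : (leb G < +oo)%E.
  apply: (@le_lt_trans _ _ (leb Q)); first exact: le_lebesgue_outer.
  by rewrite leb_cube// ltry.
(* around a point outside the stopping cubes all means of F are at most lam, so
   by Chebyshev the set where F > 2 lam fills at most half of each cube *)
have G0 : leb G = 0%E.
  apply: (density_half_eq0 (p := p) (s := s)) => // x k [[Qx Sx] _].
  set z' := dyadic_index p s k x.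
  pose C' : set (lebesgue_rV R n) := dyadic_cube p s k z'.
  have mC' : measurable C' by exact: measurable_dyadic_cube.
  have C'Q : C' `<=` Q by exact: dyadic_cube_sub.
  have l1C' : (l1dev h (dyadic_corner p s k z') (side s k) c <=
      (lam * cube_vol (side s k))%:E)%E.
    rewrite leNgt; apply/negP => big; apply: Sx.
    by have [m Dm Cx] := Dcover k x (conj C'Q big); exists m.
  have : ((2 * lam)%:E * leb (G `&` C') <= (lam * cube_vol (side s k))%:E)%E.
    apply: le_trans l1C'.
    apply: (@le_trans _ _ (\int[leb]_(y in G `&` C') (F y)%:E)%E).
      have mGC : measurable (G `&` C') by exact: measurableI.
      rewrite -(integral_EFin_cst leb mGC).
      apply: (integral_EFin_le leb mGC (measurable_cst _) mF).
        by move=> y /=; rewrite mulr_ge0// ltW.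
      by move=> y [[_ /= /ltW]].
    apply: (integral_EFin_subset leb mC') => //; first exact: measurableI.
  rewrite -lee_pdivlMl ?mulr_gt0// => /le_trans; apply.
  rewrite leb_dyadic_cube// -!EFinM lee_fin invfM -/(cube_vol _) -mulrA.
  by rewrite mulKf ?gt_eqF.
have mQS : measurable (Q `\` S : set (lebesgue_rV R n)) by exact: measurableD.
have l2QS : (\int[leb]_(y in Q `\` S) (F y ^+ 2)%:E <=
    (64 * d ^+ 2 * cube_vol s)%:E)%E.
  rewrite (ge0_negligible_integral mG mQS _ _ G0); last 2 first.
  - by apply/measurable_EFinP; exact: measurable_funTS.
  - by move=> y _; rewrite lee_fin.
  have mQSG : measurable ((Q `\` S) `\` G : set (lebesgue_rV R n)).
    exact: measurableD.
  apply: (@le_trans _ _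
      (\int[leb]_(y in (Q `\` S) `\` G) ((2 * lam) ^+ 2)%:E)%E).
    apply: (integral_EFin_le leb mQSG mF2 (measurable_cst _) F20).
    move=> y [QSy Gy]; have Fy : F y <= 2 * lam.
      by rewrite leNgt; apply/negP => Fy; apply: Gy.
    by rewrite /= lerXn2r ?nnegrE ?F0// mulr_ge0// ltW.
  rewrite integral_EFin_cst// (_ : 64 * _ * _ = (2 * lam) ^+ 2 * cube_vol s).
    rewrite [in leRHS]EFinM -[(cube_vol s)%:E](leb_cube p s_gt0); apply: lee_wpmul2l.
      by rewrite lee_fin exprn_ge0// mulr_ge0// ltW.
    by apply: le_lebesgue_outer => y [[]].
  by rewrite /lam; ring.
rewrite /l2dev -/Q (_ : Q = (Q `\` S) `|` S); last first.
  by rewrite setUC setDUK.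
rewrite (ge0_integral_setU leb mQS mS); last 3 first.
- by apply/measurable_EFinP; exact: measurable_funTS.
- by move=> y _; rewrite lee_fin.
- by rewrite disj_set_sym; apply/disj_setPS => y [? []].
apply: (le_trans (leeD l2QS l2S)).
by rewrite -EFinD lee_fin /jn_const -/B; lra.
Qed.

End john_nirenberg.

Section clamp.
Context {R : realType}.
Implicit Types N t u : R.

(** Truncation is 1-Lipschitz, hence does not increase deviations from
    constants, and it fixes 0. *)
Definition clamp N t : R := Num.max (- N) (Num.min N t).

Lemma norm_clamp N t : 0 <= N -> `|clamp N t| = Num.min N `|t|.
Proof.
move=> N0; rewrite /clamp; have [t0|t0] := lerP 0 t.
  by rewrite max_r ?ger0_norm// le_min; apply/andP; split; lra.
rewrite (@min_r _ _ N t); last by lra.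
rewrite ler0_norm; first by rewrite oppr_max opprK ltr0_norm.
by rewrite ge_max; apply/andP; split; lra.
Qed.

Lemma clamp_dist N t u : `|clamp N t - clamp N u| <= `|t - u|.
Proof.
have := ler_norm (t - u); have := ler_norm (u - t); rewrite distrC.
move: `|t - u| => D tuD utD; rewrite /clamp ler_norml.
case: (leP N t) => ?; case: (leP N u) => ?; case: (leP (- N) N) => ?;
  case: (leP (- N) t) => ?; case: (leP (- N) u) => ?;
  by apply/andP; split; lra.
Qed.

Lemma measurable_clamp d (T : measurableType d) N (f : T -> R) :
  measurable_fun setT f -> measurable_fun setT (fun y => clamp N (f y)).
Proof.
move=> mf; apply: measurable_maxr; first exact: measurable_cst.
by apply: measurable_minr => //; exact: measurable_cst.
Qed.

End clamp.

Section john_nirenberg_l2.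
Context {R : realType} {n' : nat}.
Local Notation n := n'.+1.
Local Notation leb := (@leb R n).
Local Notation unit_vol := (@unit_vol R n').
Local Notation cube_vol := (@cube_vol R n').
Local Notation jn_const := (@jn_const R n').
Hypothesis unit_vol_gt0 : 0 < unit_vol.
Implicit Types (h : lebesgue_rV R n -> R) (p : 'rV[R]_n) (s c d A N : R).

Lemma jn_const_ge0 : 0 <= jn_const.
Proof.
by rewrite addr_ge0// divr_ge0// exprn_ge0// addr_ge0// mulr_ge0// exprn_ge0.
Qed.

(** A bounded function satisfies the property for some A; iterating the
    improvement sends the dependence on A to 0, and 2 K is the fixed point of
    A -> A/2 + K. *)
Lemma l2dev_bounded_of_bounded h N d p0 s0 : measurable_fun setT h ->
  (forall y, `|h y| <= N) -> 0 < d ->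
  l1dev_small h d p0 s0 -> l2dev_bounded h d (2 * jn_const) p0 s0.
Proof.
move=> mh hN d0 osc.
have N0 : 0 <= N by exact: le_trans (hN 0).
pose A := ((2 * N + d) / d) ^+ 2.
have A0 : 0 <= A by exact: sqr_ge0.
have Ad : A * d ^+ 2 = (2 * N + d) ^+ 2 by rewrite -exprMn divfK// gt_eqF.
have l2A k : l2dev_bounded h d (A / 2 ^+ k + 2 * jn_const) p0 s0.
  elim: k => [|k IH].
    move=> p s c s_gt0 sQ l1c; rewrite expr0 divr1 mulrDl Ad.
    have mc := measurable_cube p s.
    have cN : `|c| <= d + N.
      have l10 : (l1dev h p s 0 <= (N * cube_vol s)%:E)%E.
        rewrite EFinM -[(cube_vol s)%:E](leb_cube p s_gt0).
        rewrite -(integral_EFin_cst leb mc).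
        apply: (integral_EFin_le leb mc (measurable_dev mh 0) (measurable_cst _)).
          by move=> y; exact: normr_ge0.
        by move=> y _; rewrite subr0 /= hN.
      by have := l1dev_const_le unit_vol_gt0 mh s_gt0 l1c l10; rewrite subr0.
    apply: (@le_trans _ _ ((2 * N + d) ^+ 2 * cube_vol s)%:E); last first.
      rewrite lee_fin ler_wpM2r ?(ltW (cube_vol_gt0 _ _))// lerDl.
      by rewrite !mulr_ge0 ?jn_const_ge0 ?exprn_ge0// ltW.
    rewrite EFinM -[(cube_vol s)%:E](leb_cube p s_gt0).
    rewrite -(integral_EFin_cst leb mc).
    apply: (integral_EFin_le leb mc (measurable_dev_sqr mh c) (measurable_cst _)).
      by move=> y; rewrite exprn_ge0.
    move=> y _; rewrite lerXn2r ?nnegrE//=.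
      by rewrite addr_ge0 ?mulr_ge0// ltW.
    by apply: (le_trans (ler_normB _ _)); have := hN y; lra.
  have B0 : 0 <= A / 2 ^+ k + 2 * jn_const.
    apply: addr_ge0; first by apply: divr_ge0 => //; exact: exprn_ge0.
    by apply: mulr_ge0 => //; exact: jn_const_ge0.
  have := l2dev_bounded_improve unit_vol_gt0 mh d0 B0 osc IH.
  rewrite (_ : _ + jn_const = A / 2 ^+ k.+1 + 2 * jn_const)//.
  by rewrite exprSr invfM; field; rewrite expf_neq0.
move=> p s c s_gt0 sQ l1c; apply/lee_addgt0Pr => e e0.
have [k ke] := side_small (A * d ^+ 2 * cube_vol s) e0.
apply: le_trans (l2A k p s c s_gt0 sQ l1c) _.
rewrite -EFinD lee_fin -lerBlDl; apply: le_trans ke.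
by rewrite [leLHS](_ : _ = side (A * d ^+ 2 * cube_vol s) k)// /side; ring.
Qed.

(** Truncations h_k of h satisfy the same hypotheses, and |h_k| increases to
    |h|. The constant 0 is the one that all truncations share. *)
Theorem john_nirenberg_l2 h d p s : measurable_fun setT h -> 0 < d -> 0 < s ->
  l1dev_small h d p s ->
  (l1dev h p s 0 <= (d * cube_vol s)%:E)%E ->
  (l2dev h p s 0 <= (2 * jn_const * d ^+ 2 * cube_vol s)%:E)%E.
Proof.
move=> mh d0 s0 osc l10.
pose g (k : nat) (y : lebesgue_rV R n) : R := clamp k%:R (h y).
have mg k : measurable_fun setT (g k) by exact: measurable_clamp.
have g_dist k y c : `|g k y - clamp k%:R c| <= `|h y - c| by exact: clamp_dist.
have clamp0 k : clamp k%:R 0 = 0 :> R.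
  by apply/eqP; rewrite -normr_eq0 norm_clamp// normr0 min_r.
have mc := measurable_cube p s.
have l1g k p' s' c : (l1dev (g k) p' s' (clamp k%:R c) <= l1dev h p' s' c)%E.
  apply: (integral_EFin_le leb (measurable_cube p' s')
    (measurable_dev (mg k) _) (measurable_dev mh _)) => y //.
have l2g k : (l2dev (g k) p s 0 <= (2 * jn_const * d ^+ 2 * cube_vol s)%:E)%E.
  have gk y : `|g k y| <= k%:R by rewrite norm_clamp// ge_min lexx.
  have osc_g : l1dev_small (g k) d p s.
    move=> p' s' s'0 /(osc p' s' s'0)[c l1c]; exists (clamp k%:R c).
    exact: le_trans (l1g _ _ _ _) l1c.
  apply: (l2dev_bounded_of_bounded (mg k) gk d0 osc_g s0 (@subset_refl _ _)).
  by have := l1g k p s 0; rewrite clamp0 => l1gh; exact: le_trans l1gh l10.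
pose G k (y : lebesgue_rV R n) : \bar R := (`|g k y - 0| ^+ 2)%:E.
have GE k y : G k y = ((Num.min k%:R `|h y|) ^+ 2)%:E.
  by rewrite /G subr0 norm_clamp.
have mG k : measurable_fun (cube p s : set (lebesgue_rV R n)) (G k).
  apply/measurable_EFinP; apply: measurable_funTS; exact: measurable_dev_sqr.
have G0 k y : cube p s y -> (0 <= G k y)%E by move=> _; rewrite lee_fin exprn_ge0.
have ndG y : cube p s y -> {homo G^~ y : a b / (a <= b)%N >-> (a <= b)%E}.
  move=> _ a b ab; rewrite !GE lee_fin lerXn2r ?nnegrE ?le_min ?ler0n ?normr_ge0//.
  by rewrite !ge_min lexx ler_nat ab orbT.
have := monotone_convergence leb mc mG G0 ndG.
rewrite (eq_integral (fun y => (`|h y - 0| ^+ 2)%:E)); last first.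
  move=> y _; rewrite subr0; apply: lim_near_cst => //.
  exists (Num.truncn `|h y|).+1; first by [].
  move=> m /= hm.
  rewrite GE min_r//; apply: (le_trans (ltW (truncnS_gt _))).
  by rewrite ler_nat.
rewrite -/(l2dev h p s 0) => ->; apply: lime_le; last first.
  by apply: nearW => k; exact: l2g.
apply: ereal_nondecreasing_is_cvgn => a b ab.
apply: ge0_le_integral => //; first by move=> y; exact: G0.
by move=> y /ndG; exact.
Qed.

End john_nirenberg_l2.

(** * Euclidean balls against cubes *)

Section euclidean_balls.
Context {R : realType} {n' : nat}.
Local Notation n := n'.+1.
Local Notation leb := (@leb R n).
Local Notation unit_vol := (@unit_vol R n').
Local Notation cube_vol := (@cube_vol R n').
Implicit Types (x y p : 'rV[R]_n) (r s : R).

(** The comparison factor between balls and cubes. The maximum norm and the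
    Euclidean norm differ by at most n; the factor 2 makes up for the strict
    inequality that defines a ball. *)
Definition ball_cube_ratio : R := 2 * n%:R.
Local Notation kappa := ball_cube_ratio.

Lemma kappa_ge2 : 2 <= kappa.
Proof. by rewrite ler_peMr// ler1n. Qed.

Lemma kappa_gt0 : 0 < kappa.
Proof. by apply: lt_le_trans kappa_ge2. Qed.

Lemma enorm_sqr x : enorm x ^+ 2 = \sum_(i < n) x ord0 i ^+ 2.
Proof. by rewrite sqr_sqrtr// sumr_ge0// => i _; exact: sqr_ge0. Qed.

Lemma le_coord_enorm x i : `|x ord0 i| <= enorm x.
Proof.
rewrite -sqrtr_sqr ler_sqrt ?sqr_ge0//; last first.
  by rewrite sumr_ge0// => j _; exact: sqr_ge0.
by rewrite (bigD1 i)//= lerDl sumr_ge0// => j _; exact: sqr_ge0.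
Qed.

Lemma enorm_le x r : (forall i, `|x ord0 i| <= r) -> enorm x <= n%:R * r.
Proof.
move=> xr; have r0 : 0 <= r by exact: le_trans (xr ord0).
rewrite -(@ler_pXn2r _ 2)// ?nnegrE ?sqrtr_ge0 ?mulr_ge0//.
rewrite enorm_sqr (@le_trans _ _ (\sum_(i < n) r ^+ 2))//.
  by apply: ler_sum => i _; rewrite -real_normK ?num_real// lerXn2r ?nnegrE.
rewrite sumr_const card_ord exprMn -[leLHS]mulr_natl ler_wpM2r ?sqr_ge0//.
by rewrite expr2 ler_peMl// ler1n.
Qed.

Lemma cube_sub_eball p s x r : 0 < r ->
  (forall i, x ord0 i - r <= p ord0 i) ->
  (forall i, p ord0 i + s <= x ord0 i + r) ->
  cube p s `<=` eball x (kappa * r).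
Proof.
move=> r0 xp px y /cubeP py; rewrite /eball/=.
apply: (@le_lt_trans _ _ (n%:R * r)).
  apply: enorm_le => i; rewrite !mxE.
  have := py i; have := xp i; have := px i => h1 h2 /andP[h3 h4].
  by rewrite ler_norml; apply/andP; split; lra.
by rewrite /kappa -mulrA ltr_pMl ?ltr1n// mulr_gt0// ltr0n.
Qed.

Lemma eball_sub_cube x r : eball x r `<=` cube (x - const_mx r) (2 * r).
Proof.
move=> y /= yr; apply/cubeP => i.
have := le_lt_trans (le_coord_enorm _ i) yr; rewrite !mxE.
by rewrite ltr_norml => /andP[h1 h2]; apply/andP; split; lra.
Qed.

Lemma measurable_eball x r : measurable (eball x r : set (lebesgue_rV R n)).
Proof.
have [r0|r0] := leP r 0.
  rewrite (_ : eball x r = set0); first exact: measurable0.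
  apply/seteqP; split => // y /= /lt_le_trans/(_ r0).
  by rewrite ltNge sqrtr_ge0.
rewrite (_ : eball x r =
    [set y : lebesgue_rV R n | \sum_(i < n) (y ord0 i - x ord0 i) ^+ 2 < r ^+ 2]).
  rewrite -[X in measurable X]setTI.
  have mS : measurable_fun setT
      (fun y : lebesgue_rV R n => \sum_(i < n) ((y : 'rV[R]_n) ord0 i - x ord0 i) ^+ 2).
    apply: measurable_sum => i; apply: measurable_funX; apply: measurable_funB.
      exact: measurable_coord.
    exact: measurable_cst.
  by have := measurable_fun_ltr mS (measurable_cst (r ^+ 2)) => /(_ measurableT [set true] I).
apply/seteqP; split => y /=.
  move=> yr; rewrite (eq_bigr (fun i => ((y - x) ord0 i) ^+ 2)); last first.
    by move=> i _; rewrite !mxE.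
  by rewrite -enorm_sqr ltr_pXn2r ?nnegrE ?sqrtr_ge0// ltW.
rewrite (eq_bigr (fun i => ((y - x) ord0 i) ^+ 2)); last first.
  by move=> i _; rewrite !mxE.
by rewrite -enorm_sqr ltr_pXn2r ?nnegrE ?sqrtr_ge0// ltW.
Qed.

Lemma leb_eball_le x r : 0 < r -> (leb (eball x r) <= (cube_vol (2 * r))%:E)%E.
Proof.
move=> r0; rewrite -(leb_cube (x - const_mx r)) ?mulr_gt0//.
by apply: le_lebesgue_outer; exact: eball_sub_cube.
Qed.

Lemma leb_eball_ge x r : 0 < r -> ((cube_vol (r / kappa))%:E <= leb (eball x r))%E.
Proof.
move=> r0; have s0 : 0 < r / kappa by rewrite divr_gt0 ?kappa_gt0.
rewrite -(leb_cube x)//; apply: le_lebesgue_outer.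
have {2}-> : r = kappa * (r / kappa) by rewrite mulrC divfK ?gt_eqF ?kappa_gt0.
by apply: cube_sub_eball => // i; lra.
Qed.

Lemma leb_eball_fin x r : 0 < r -> leb (eball x r) \is a fin_num.
Proof.
move=> r0; rewrite ge0_fin_numE ?lebesgue_outer_ge0//.
by apply: le_lt_trans (leb_eball_le x r0) _; rewrite ltry.
Qed.

Hypothesis unit_vol_gt0 : 0 < unit_vol.

Lemma leb_eball_gt0 x r : 0 < r -> 0 < fine (leb (eball x r)).
Proof.
move=> r0; rewrite -lte_fin fineK ?leb_eball_fin//.
apply: lt_le_trans (leb_eball_ge x r0).
by rewrite lte_fin cube_vol_gt0// divr_gt0// kappa_gt0.
Qed.

Lemma integral_eball_le (g : 'rV[R]_n -> \bar R) x r (a : R) : 0 < r -> 0 <= a ->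
  (emean g x r <= a%:E)%E ->
  (\int[leb]_(y in eball x r) g y <= (a * cube_vol (2 * r))%:E)%E.
Proof.
move=> r0 a0; have v0 := leb_eball_gt0 x r0.
rewrite /emean lee_pdivrMl// => /le_trans; apply.
rewrite -EFinM lee_fin mulrC ler_wpM2l// -lee_fin fineK ?leb_eball_fin//.
exact: leb_eball_le.
Qed.

Lemma emean_le (g : 'rV[R]_n -> \bar R) x r (a : R) : 0 < r -> 0 <= a ->
  (\int[leb]_(y in eball x r) g y <= (a * cube_vol (r / kappa))%:E)%E ->
  (emean g x r <= a%:E)%E.
Proof.
move=> r0 a0 ga; have v0 := leb_eball_gt0 x r0.
rewrite /emean lee_pdivrMl//; apply: (le_trans ga).
rewrite -EFinM lee_fin mulrC ler_wpM2r// -lee_fin fineK ?leb_eball_fin//.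
exact: leb_eball_ge.
Qed.

End euclidean_balls.

(** * Lower bound for the critical radius on bounded sets *)

Section critical_radius.
Context {R : realType} {n' : nat}.
Local Notation n := n'.+1.
Local Notation leb := (@leb R n).
Local Notation unit_vol := (@unit_vol R n').
Local Notation cube_vol := (@cube_vol R n').
Implicit Types (x y p : 'rV[R]_n) (r s : R).
Hypothesis unit_vol_gt0 : 0 < unit_vol.

Lemma locally_integrable_eball (f : 'rV[R]_n -> R) x r :
  locally_integrable_rV f -> (\int[leb]_(y in eball x r) `|f y|%:E < +oo)%E.
Proof.
move=> [mf intf].
pose K : set 'rV[R]_n :=
  [set v | forall i, `[x ord0 i - r, x ord0 i + r]%classic (v ord0 i)].
have cK : compact K.
  apply: (rV_compact (A := fun i => `[x ord0 i - r, x ord0 i + r]%classic)) => i.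
  exact: segment_compact.
have mK : measurable (K : set (lebesgue_rV R n)).
  rewrite (_ : K = \bigcap_(i in [set: 'I_n])
      ((fun v : 'rV[R]_n => v ord0 i) @^-1` `[x ord0 i - r, x ord0 i + r]%classic)).
    apply: (@fin_bigcap_measurable _ (lebesgue_rV R n)) => // i _.
    rewrite -[X in measurable X]setTI.
    exact: (measurable_coord i measurableT (measurable_itv _)).
  by apply/seteqP; split => [v Kv i _|v Kv i]; [exact: Kv|exact: Kv].
apply: le_lt_trans (intf K cK).
apply: (integral_EFin_subset leb mK (measurable_eball x r)).
- by apply: measurableT_comp; first exact: normr_measurable.
- by move=> y; exact: normr_ge0.
move=> y yr i; rewrite /= in_itv/=.
have := le_lt_trans (le_coord_enorm _ i) yr; rewrite !mxE.
by rewrite ltr_norml => /andP[h1 h2]; apply/andP; split; lra.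
Qed.

(** The right-hand side of the reverse Hoelder inequality is finite, and the
    left-hand side would be infinite if the integral were. *)
Lemma reverse_Holder_integral_lty (V : 'rV[R]_n -> R) (q : R) x r :
  0 < q -> 0 < r -> reverse_Holder q V ->
  (\int[leb]_(y in eball x r) (V y `^ q)%:E < +oo)%E.
Proof.
move=> q0 r0 [V0 liV [C C0 VC]].
have v0 := leb_eball_gt0 unit_vol_gt0 x r0.
have : (poweR (emean (fun y => (V y `^ q)%:E) x r) q^-1 < +oo)%E.
  apply: le_lt_trans (VC x r r0) _; rewrite lte_mul_pinfty ?lee_fin ?ltW//.
  rewrite /emean lte_mul_pinfty ?lee_fin ?invr_ge0 ?ltW//.
  under eq_integral do rewrite -[V _]ger0_norm//.
  exact: locally_integrable_eball.
move=> /(lty_poweRy (invr_neq0 (lt0r_neq0 q0))); rewrite !ltey.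
apply: contra => /eqP oo; apply/eqP.
by rewrite /emean oo gt0_muley// lte_fin invr_gt0.
Qed.

(** Where v > L, write v = v^q / v^(q-1) and bound the denominator below. *)
Lemma le_add_powR (q L v : R) : 1 < q -> 0 < L -> 0 <= v ->
  v <= L + (L `^ (q - 1))^-1 * v `^ q.
Proof.
move=> q1 L0 v0; have Lq : 0 < L `^ (q - 1) by exact: powR_gt0.
have [vL|Lv] := leP v L.
  by rewrite (le_trans vL)// lerDl mulr_ge0 ?powR_ge0// invr_ge0 ltW.
rewrite (@le_trans _ _ ((L `^ (q - 1))^-1 * v `^ q))//; last by rewrite lerDr ltW.
have vgt0 : 0 < v by exact: lt_trans Lv.
rewrite ler_pdivlMl// -[in leRHS](subrK 1 q) (@powRD _ v); last first.
  by apply/implyP => _; rewrite gt_eqF.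
rewrite powRr1// ler_wpM2r//; apply: ge0_ler_powR; rewrite ?nnegrE ?ltW//.
by rewrite subr_gt0.
Qed.

(** A single radius that is admissible in the definition of the critical radius
    at all points of a bounded set is enough. In dimension 1 the factor
    r^(2-n) is r, and local integrability of V suffices; in dimension n >= 2 the
    exponent q is larger than 1, and V is split at the level L = a / r^2. *)
Lemma critical_radius_ge (V : 'rV[R]_n -> R) (q M : R) :
  n%:R / 2 < q -> reverse_Holder q V ->
  exists2 r, 0 < r & forall x, (forall i, `|x ord0 i| <= M) ->
    (r%:E <= critical_radius V x)%E.
Proof.
move=> nq RH; have [V0 liV _] := RH; have mV := liV.1.
have q0 : 0 < q by apply: lt_trans nq; rewrite divr_gt0// ltr0n.
(* all balls of radius at most 1 centered in the bounded set lie in this one *)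
pose Rb := Num.max 1 (n%:R * (M + 1) + 1).
have Rb0 : 0 < Rb by rewrite lt_max ltr01.
have ball_sub r x : r <= 1 -> (forall i, `|x ord0 i| <= M) ->
    eball x r `<=` eball 0 Rb.
  move=> r1 xM y yr; rewrite /eball/= subr0.
  rewrite lt_max; apply/orP; right.
  apply: (@le_lt_trans _ _ (n%:R * (M + 1))); last by rewrite ltrDl.
  apply: enorm_le => i; rewrite -(subrK (x ord0 i) (y ord0 i)) addrC.
  apply: (le_trans (ler_normD _ _)); apply: lerD; first exact: xM.
  have := ltW (le_lt_trans (le_coord_enorm _ i) yr).
  by rewrite !mxE => /le_trans; apply.
suff [r r0 [r1 rV]] : exists2 r, 0 < r & r <= 1 /\
    forall x, (forall i, `|x ord0 i| <= M) ->
    ((r ^ (2%:Z - n%:Z))%:E * \int[leb]_(h in eball x r) (V h)%:E <= 1)%E.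
  exists r => // x xM; apply: ereal_sup_ubound; exists r => //; split => //.
  exact: rV.
have mball r x : measurable (eball x r : set (lebesgue_rV R n)).
  exact: measurable_eball.
have intV_le r x : r <= 1 -> (forall i, `|x ord0 i| <= M) ->
    (\int[leb]_(y in eball x r) (V y)%:E <=
     \int[leb]_(y in eball 0%R Rb) (V y)%:E)%E.
  move=> r1 xM; apply: (integral_EFin_subset leb (mball _ _) (mball _ _)) => //.
  exact: ball_sub.
have mVq : measurable_fun setT (fun y : lebesgue_rV R n => V y `^ q).
  by apply: (measurableT_comp (f := fun t : R => t `^ q)); first exact: measurable_powR.
have intVq_le r x : r <= 1 -> (forall i, `|x ord0 i| <= M) ->
    (\int[leb]_(y in eball x r) (V y `^ q)%:E <=
     \int[leb]_(y in eball 0%R Rb) (V y `^ q)%:E)%E.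
  move=> r1 xM; apply: (integral_EFin_subset leb (mball _ _) (mball _ _)) => //.
    by move=> y; exact: powR_ge0.
  exact: ball_sub.
have [I1 I10 EI1] : exists2 I1 : R, 0 <= I1 &
    (\int[leb]_(y in eball 0%R Rb) (V y)%:E = I1%:E)%E.
  have I0 : (0 <= \int[leb]_(y in eball 0%R Rb) (V y)%:E)%E.
    by apply: integral_ge0 => y _; rewrite lee_fin.
  exists (fine (\int[leb]_(y in eball 0%R Rb) (V y)%:E)%E); first exact: fine_ge0.
  rewrite fineK// ge0_fin_numE//.
  under eq_integral do rewrite -[V _]ger0_norm//.
  exact: locally_integrable_eball.
have [Iq Iq0 EIq] : exists2 Iq : R, 0 <= Iq &
    (\int[leb]_(y in eball 0%R Rb) (V y `^ q)%:E = Iq%:E)%E.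
  have I0 : (0 <= \int[leb]_(y in eball 0%R Rb) (V y `^ q)%:E)%E.
    by apply: integral_ge0 => y _; rewrite lee_fin powR_ge0.
  exists (fine (\int[leb]_(y in eball 0%R Rb) (V y `^ q)%:E)%E); first exact: fine_ge0.
  by rewrite fineK// ge0_fin_numE// (reverse_Holder_integral_lty _ q0).
have [n1|[m n2]] : n = 1%N \/ exists m, n = m.+2.
  by case: (n') => [|m]; [left|right; exists m].
  exists (I1 + 1)^-1; first by rewrite invr_gt0 ltr_wpDl.
  have r1 : (I1 + 1)^-1 <= 1 by rewrite invf_le1 ?lerDr// ltr_wpDl.
  split=> // x xM; rewrite (_ : 2%:Z - n%:Z = 1) ?n1// expr1z.
  apply: (@le_trans _ _ ((I1 + 1)^-1%:E * I1%:E)%E).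
    rewrite lee_wpmul2l//; first by rewrite lee_fin invr_ge0 addr_ge0.
    by rewrite -EI1; exact: intV_le.
  by rewrite -EFinM lee_fin ler_pdivrMl ?ltr_wpDl// mulr1 lerDl.
have q1 : 1 < q.
  apply: le_lt_trans nq; rewrite n2 ler_pdivlMr// mul1r ler_nat//.
(* a is chosen so that L times the volume of a cube of side 2 r, which contains
   the ball of radius r, is r^(n-2) / 2; and b so that r^(2q-n) <= b bounds the
   term in V^q by the same quantity. *)
pose a := (2 * unit_vol * 2 ^+ n)^-1.
have a0 : 0 < a by rewrite invr_gt0 !mulr_gt0// exprn_gt0.
pose e := 2 * q - n%:R.
have e0 : 0 < e by move: nq; rewrite /e ltr_pdivrMr//; lra.
pose b := a `^ (q - 1) / (2 * (Iq + 1)).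
have b0 : 0 < b by rewrite divr_gt0 ?powR_gt0// mulr_gt0// ltr_wpDl.
pose r := Num.min 1 (b `^ e^-1).
have r0 : 0 < r by rewrite lt_min ltr01 powR_gt0.
have r1 : r <= 1 by rewrite ge_min lexx.
have rb : r `^ e <= b.
  rewrite (_ : b = (b `^ e^-1) `^ e); last first.
    by rewrite -powRrM mulVf ?gt_eqF// powRr1 ?ltW.
  have rb : r <= b `^ e^-1 by rewrite ge_min lexx orbT.
  by apply: ge0_ler_powR; rewrite ?nnegrE ?powR_ge0// ltW.
pose L := a / r ^+ 2.
have L0 : 0 < L by rewrite divr_gt0// exprn_gt0.
have rm0 : 0 < r ^+ m by rewrite exprn_gt0.
have Lq0 : 0 < L `^ (q - 1) by exact: powR_gt0.
have LIq : (L `^ (q - 1))^-1 * Iq <= r ^+ m / 2.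
  have r2 : 0 < (r ^+ 2)^-1 by rewrite invr_gt0 exprn_gt0.
  rewrite ler_pdivrMl// /L (powRM _ (ltW a0) (ltW r2)).
  have rq : (r ^+ 2)^-1 `^ (q - 1) * (r ^+ m * r `^ e) = 1.
    rewrite -(@powR_mulrn _ r m) ?ltW// -powRD; last by apply/implyP => _; rewrite gt_eqF.
    rewrite -(@powR_mulrn _ r 2) ?ltW// -powRN -powRrM -powRD; last first.
      by apply/implyP => _; rewrite gt_eqF.
    rewrite (_ : _ + _ = 0) ?powRr0// /e n2 -[m.+2]addn2 natrD; lra.
  have re0 : 0 < r `^ e by exact: powR_gt0.
  have -> : (r ^+ 2)^-1 `^ (q - 1) = (r ^+ m * r `^ e)^-1.
    by apply: (mulIf (lt0r_neq0 (mulr_gt0 rm0 re0))); rewrite rq mulVf ?gt_eqF// mulr_gt0.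
  have : r `^ e * (2 * (Iq + 1)) <= a `^ (q - 1).
    by rewrite -ler_pdivlMr// mulr_gt0// ltr_wpDl.
  move=> h; rewrite invfM.
  rewrite (_ : _ * (r ^+ m / 2) = a `^ (q - 1) / r `^ e / 2); last first.
    by field; rewrite !gt_eqF.
  rewrite ler_pdivlMr// ler_pdivlMr//; nra.
have Lvol : L * cube_vol (2 * r) = r ^+ m / 2.
  rewrite /L /a /cube_vol exprMn n2 -[m.+2]addn2 !exprD; field.
  by rewrite !gt_eqF ?exprn_gt0.
exists r => //; split => // x xM.
rewrite (_ : 2%:Z - n%:Z = - m%:Z) -?exprnN; last first.
  by rewrite n2 -[m.+2]addn2 PoszD opprD addrCA subrr addr0.
rewrite lee_pdivrMl// mule1.
apply: (@le_trans _ _ (\int[leb]_(y in eball x r)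
    (L + (L `^ (q - 1))^-1 * V y `^ q)%:E)%E).
  have mR : measurable_fun setT (fun y : lebesgue_rV R n =>
      L + (L `^ (q - 1))^-1 * V y `^ q).
    apply: (measurable_funD (measurable_cst _)).
    exact: (measurable_funM (measurable_cst _)).
  apply: (integral_EFin_le leb (mball _ _) mV mR) => // y _.
  exact: le_add_powR.
rewrite (integral_EFinD leb (mball _ _) (measurable_cst L)
  (measurable_funM (measurable_cst _) mVq)); last 2 first.
- by move=> y; exact: ltW.
- by move=> y; rewrite mulr_ge0 ?powR_ge0// invr_ge0 ltW.
rewrite (integral_EFin_cst leb (mball _ _)).
rewrite (integral_EFinZ leb (mball _ _) mVq); last 2 first.
- by move=> y; exact: powR_ge0.
- by rewrite invr_ge0 ltW.
rewrite [X in (_ <= X%:E)%E](_ : _ = r ^+ m / 2 + r ^+ m / 2); last by field.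
rewrite EFinD; apply: leeD.
  rewrite -Lvol [in leRHS]EFinM; apply: lee_wpmul2l; first by rewrite lee_fin ltW.
  exact: leb_eball_le.
apply: (@le_trans _ _ ((L `^ (q - 1))^-1%:E * Iq%:E)%E).
  apply: lee_wpmul2l; first by rewrite lee_fin invr_ge0 ltW.
  by rewrite -EIq; exact: intVq_le.
by rewrite -EFinM lee_fin.
Qed.

End critical_radius.

(** * Quadratic means on small balls *)

Section mean_square.
Context {R : realType} {n' : nat}.
Local Notation n := n'.+1.
Local Notation leb := (@leb R n).
Local Notation unit_vol := (@unit_vol R n').
Local Notation cube_vol := (@cube_vol R n').
Local Notation kappa := (@ball_cube_ratio R n').
Local Notation jn_const := (@jn_const R n').
Implicit Types (x y p : 'rV[R]_n) (r s d : R).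

(** One factor (2 kappa)^n comes from comparing the volume of the ball with
    that of the cube in which the inequality is applied, and two from the change
    from balls to cubes in the deviation, which enters squared. *)
Definition mean_square_const : R := 2 * jn_const * (2 * kappa) ^+ n ^+ 3.

Lemma mean_square_const_ge0 : 0 <= mean_square_const.
Proof.
apply: mulr_ge0; first by apply: mulr_ge0 => //; exact: jn_const_ge0.
by rewrite !exprn_ge0// mulr_ge0// ltW// kappa_gt0.
Qed.

Lemma cube_volM (l s : R) : cube_vol (l * s) = l ^+ n * cube_vol s.
Proof. by rewrite /cube_vol exprMn mulrCA. Qed.

(** The John-Nirenberg inequality transferred to balls, on the smallest cube
    around the ball. *)
Lemma emean_sqr_le (f : lebesgue_rV R n -> R) d x r : 0 < unit_vol ->
  measurable_fun setT f -> 0 < d -> 0 < r ->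
  (forall p s, 0 < s -> cube p s `<=` cube (x - const_mx r) (2 * r) ->
    exists c, (\int[leb]_(y in eball p (kappa * s)) `|f y - c|%:E <=
      (d * cube_vol (2 * (kappa * s)))%:E)%E) ->
  (\int[leb]_(y in eball x (kappa * (2 * r))) `|f y|%:E <=
      (d * cube_vol (2 * (kappa * (2 * r))))%:E)%E ->
  (emean (fun y => (`|f y| ^+ 2)%:E) x r <= (mean_square_const * d ^+ 2)%:E)%E.
Proof.
move=> w0 mf d0 r0 osc fl1; have k0 := @kappa_gt0 R n'.
have r20 : 0 < 2 * r by rewrite mulr_gt0.
pose D := d * (2 * kappa) ^+ n.
have D0 : 0 < D by rewrite mulr_gt0// exprn_gt0// mulr_gt0.
have DE s : d * cube_vol (2 * (kappa * s)) = D * cube_vol s.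
  by rewrite mulrA cube_volM mulrA.
pose Q : set (lebesgue_rV R n) := cube (x - const_mx r) (2 * r).
have mQ : measurable Q by exact: measurable_cube.
have mB p s : measurable (eball p s : set (lebesgue_rV R n)).
  exact: measurable_eball.
have oscD : l1dev_small f D (x - const_mx r) (2 * r).
  move=> p s s0 /(osc p s s0)[c fc]; exists c; rewrite -DE.
  apply: le_trans fc.
  apply: (integral_EFin_subset leb (mB _ _) (measurable_cube _ _) (measurable_dev mf c)).
    by move=> y; exact: normr_ge0.
  by apply: cube_sub_eball => // i; lra.
have l10 : (l1dev f (x - const_mx r) (2 * r) 0 <= (D * cube_vol (2 * r))%:E)%E.
  rewrite -DE; apply: le_trans fl1; rewrite /l1dev.
  under eq_integral do rewrite subr0.
  apply: (integral_EFin_subset leb (mB _ _) mQ).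
  - by apply: measurableT_comp; first exact: normr_measurable.
  - by move=> y; exact: normr_ge0.
  by apply: cube_sub_eball => // i; rewrite !mxE; lra.
have l20 := john_nirenberg_l2 w0 mf D0 r20 oscD l10.
apply: emean_le => //.
  by rewrite mulr_ge0 ?mean_square_const_ge0// exprn_ge0// ltW.
have -> : mean_square_const * d ^+ 2 * cube_vol (r / kappa) =
    2 * jn_const * D ^+ 2 * cube_vol (2 * r).
  have -> : 2 * r = 2 * kappa * (r / kappa) by field; rewrite gt_eqF.
  by rewrite (cube_volM (2 * kappa)) /mean_square_const /D; ring.
apply: le_trans l20; rewrite /l2dev.
under [leRHS]eq_integral do rewrite subr0.
apply: (integral_EFin_subset leb mQ (mB _ _)).
- apply: measurable_funX.
  by apply: measurableT_comp; first exact: normr_measurable.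
- by move=> y; rewrite exprn_ge0.
exact: eball_sub_cube.
Qed.

End mean_square.

Section small_balls.
Context {R : realType} {n' : nat}.
Local Notation n := n'.+1.
Local Notation leb := (@leb R n).
Local Notation unit_vol := (@unit_vol R n').
Local Notation kappa := (@ball_cube_ratio R n').
Implicit Types (x y p : 'rV[R]_n) (r s : R).

Lemma unit_vol_gt0_of_not_ae0 (V : 'rV[R]_n -> R) :
  ~ (\forall x \ae leb, V x = 0) -> 0 < unit_vol.
Proof.
move=> V_neq0; apply: unit_vol_gt0_of_setT; apply/eqP => leb0; apply: V_neq0.
by exists setT; split => //; exact: measurableT.
Qed.

Lemma compact_support_bounded (g : 'rV[R]_n -> R) :
  compact (closure [set x | g x != 0]) ->
  exists M : R, forall y, (exists i, M < `|y ord0 i|) -> g y = 0.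
Proof.
move=> /compact_bounded[M [_ HM]]; exists (M + 1) => y [i yi].
apply/eqP; apply: contraPT yi => gy; apply/negP; rewrite -leNgt.
have : `|y| <= M + 1.
  by apply: HM; [rewrite ltrDl|exact: subset_closure].
apply: le_trans; rewrite [leRHS]/Num.norm/= mx_normrE.
by apply: (le_bigmax _ (fun ij => `|y ij.1 ij.2|) (ord0, i)).
Qed.

Lemma nneg_sup_ge (S : set (\bar R)) t : S t -> (t <= nneg_sup S)%E.
Proof. by move=> St; apply: ereal_sup_ubound; right. Qed.

Lemma nneg_sup_ge0 (S : set (\bar R)) : (0 <= nneg_sup S)%E.
Proof. by apply: ereal_sup_ubound; left. Qed.

Lemma nneg_sup_le (S : set (\bar R)) t :
  (0 <= t)%E -> (forall u, S u -> (u <= t)%E) -> (nneg_sup S <= t)%E.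
Proof. by move=> t0 St; apply: ge_ereal_sup => u [->//|/St]. Qed.

(** With sigma below the lower bound of the critical radius near the support of
    g, every ball considered is far from that support. *)
Lemma small_balls_mean_square (V : 'rV[R]_n -> R) (q : R) (f : 'rV[R]_n -> R)
    (eps : R) : 0 < unit_vol -> n%:R / 2 < q -> reverse_Holder q V ->
  CMO_L V f -> 0 < eps ->
  exists2 sigma : R, 0 < sigma & forall x r, 0 < r -> r <= sigma ->
    (critical_radius V x <= r%:E)%E ->
    (emean (fun y => (`|f y| ^+ 2)%:E) x r <= (eps ^+ 2)%:E)%E.
Proof.
move=> w0 nq V_RH [[[mf _] _] f_approx] eps0; have k0 := @kappa_gt0 R n'.
pose W := @mean_square_const R n'; have W0 : 0 <= W := mean_square_const_ge0.
pose d := eps / (W + 1).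
have d0 : 0 < d by rewrite divr_gt0// ltr_wpDl.
have Wd : W * d ^+ 2 <= eps ^+ 2.
  rewrite /d expr_div_n mulrA mulrAC -[leRHS]mul1r ler_wpM2r ?sqr_ge0//.
  by rewrite ler_pdivrMr ?exprn_gt0 ?ltr_wpDl// mul1r; nra.
have [g [_ cg] fg] := f_approx d d0.
have [M gM] := compact_support_bounded cg.
pose M' := M + 4 * kappa + 6.
have [r1 r10 r1V] := critical_radius_ge w0 M' nq V_RH.
exists (Num.min 1 (r1 / 2)); first by rewrite lt_min ltr01 divr_gt0.
move=> x r r0; rewrite le_min => /andP[rle1 rler1] crit.
(* the center is outside the region where the critical radius exceeds sigma *)
have [i xi] : exists i, M' < `|x ord0 i|.
  apply/not_existsP => xM; have : (r1%:E <= r%:E)%E.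
    by apply: le_trans crit; apply: r1V => i; rewrite leNgt; apply/negP; exact: xM.
  by rewrite lee_fin; lra.
(* balls used below have their points within 4 kappa + 6 of x: the comparison
   ball of a cube of side s < 4 r has radius kappa s, and r <= 1 *)
have g0 y : `|y ord0 i - x ord0 i| <= 4 * kappa + 6 -> g y = 0.
  move=> yx; apply: gM; exists i; rewrite distrC in yx.
  have := lerB_dist (x ord0 i) (y ord0 i); move: xi; rewrite /M'; lra.
pose h : 'rV[R]_n -> R := f \- g.
have [osc large] : (nneg_sup (mean_oscillations h) < d%:E)%E /\
    (nneg_sup (large_ball_means V h) < d%:E)%E.
  by split; apply: le_lt_trans fg; rewrite ?leeDl ?leeDr ?nneg_sup_ge0.
have near_ball p s y : eball p s y -> `|y ord0 i - p ord0 i| < s.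
  by move=> ys; have := le_lt_trans (le_coord_enorm _ i) ys; rewrite !mxE.
apply: (@le_trans _ _ (W * d ^+ 2)%:E); last by rewrite lee_fin.
apply: emean_sqr_le => //.
  move=> p s s0 pQ; exists (mean h p (kappa * s)).
  have ks0 : 0 < kappa * s by rewrite mulr_gt0.
  have sub y : eball p (kappa * s) y -> g y = 0.
    move=> /near_ball yp; apply: g0.
    have /pQ/cubeP/(_ i) : cube p s (p + const_mx s).
      by apply/cubeP => j; rewrite !mxE ltrDl s0 lexx.
    have /pQ/cubeP/(_ i) : cube p s (p + const_mx (s / 2)).
      by apply/cubeP => j; rewrite !mxE; apply/andP; split; lra.
    rewrite !mxE => /andP[h1 h2] /andP[h3 h4].
    have s4 : s <= 4 * r by lra.
    have : kappa * s <= kappa * 4 by rewrite ler_wpM2l ?(ltW k0)//; lra.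
    move: yp; rewrite ltr_norml ler_norml => /andP[h5 h6] h7.
    by apply/andP; split; lra.
  rewrite (eq_integral (fun y : lebesgue_rV R n => `|h y - mean h p (kappa * s)|%:E)).
    apply: (integral_eball_le w0 ks0 (ltW d0)).
    apply: ltW; apply: le_lt_trans osc; apply: nneg_sup_ge.
    by exists p, (kappa * s).
  by move=> y; rewrite inE => /sub gy; rewrite /h /= gy subr0.
have k2r0 : 0 < kappa * (2 * r) by rewrite !mulr_gt0.
rewrite (eq_integral (fun y : lebesgue_rV R n => `|h y|%:E)).
  apply: (integral_eball_le w0 k2r0 (ltW d0)).
  apply: ltW; apply: le_lt_trans large; apply: nneg_sup_ge.
  exists x, (kappa * (2 * r)); split => //.
  apply: le_lt_trans crit _; rewrite lte_fin.
  by have := @kappa_ge2 R n'; nra.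
move=> y; rewrite inE => /near_ball yx; rewrite /h /= g0 ?subr0//.
apply: (le_trans (ltW yx)).
have : kappa * (2 * r) <= kappa * 2 by rewrite ler_wpM2l ?(ltW k0)//; lra.
by move: k0; lra.
Qed.

End small_balls.

Theorem lemma2p7 (R : realType) (n : nat) (n_gt0 : (0 < n)%N)
    (V : 'rV[R]_n -> R) (q : R)
    (V_neq0 : ~ (\forall x \ae (@leb R n), V x = 0))
    (q_gt : n%:R / 2 < q) (V_RH : reverse_Holder q V)
    (f : 'rV[R]_n -> R) (f_CMO : CMO_L V f) (eps : R) (eps_gt0 : 0 < eps) :
  exists2 sigma : R, 0 < sigma &
    (nneg_sup [set t | exists (x : 'rV[R]_n) (r : R),
      [/\ 0 < r, r <= sigma, (critical_radius V x <= r%:E)%E &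
        t = poweR (emean (fun y => (`|f y| ^+ 2)%:E) x r) 2^-1]%R] < eps%:E)%E.
Proof.
case: n n_gt0 V V_neq0 q_gt V_RH f f_CMO => // n' _ V V_neq0 q_gt V_RH f f_CMO.
have w0 := unit_vol_gt0_of_not_ae0 V_neq0.
have eps20 : 0 < eps / 2 by rewrite divr_gt0.
have [sigma sigma0 Hsigma] := small_balls_mean_square w0 q_gt V_RH f_CMO eps20.
exists sigma => //; apply: (@le_lt_trans _ _ (eps / 2)%:E); last first.
  by rewrite lte_fin; lra.
apply: nneg_sup_le; first by rewrite lee_fin ltW.
move=> _ [x [r [r0 rs crit ->]]].
apply: (@le_trans _ _ (poweR ((eps / 2) ^+ 2)%:E 2^-1)).
  have m0 : (0 <= emean (fun y => (`|f y| ^+ 2)%:E) x r)%E.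
    rewrite /emean mule_ge0 ?lee_fin ?invr_ge0 ?fine_ge0 ?lebesgue_outer_ge0//.
    by apply: integral_ge0 => y _; rewrite lee_fin exprn_ge0.
  apply: gt0_ler_poweR; rewrite ?in_itv/= ?leey ?andbT ?lee_fin ?sqr_ge0 ?invr_ge0//.
  exact: Hsigma.
by rewrite poweR_EFin powR12_sqrt ?sqr_ge0// sqrtr_sqr gtr0_norm.
Qed.
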